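(* Let $p$ be a prime, let $k$ be an algebraically closed field of characteristic $p$, let $E$ be a finite elementary abelian $p$-group of rank $c$, and identify $kE$ with $k[x_1,\dots,x_c]/(x_1^p,\dots,x_c^p)$. Let $1\le d\le c$, and let $\beta:\mathrm{G}_d(kE_1)\to \mathrm{G}_d(V)$ be the map of Grassmann varieties induced by the $p$-th power map $\alpha: kE_1\to V$, as defined in the context. Then for all finitely generated $kE$-modules $M$ and $N$ one has $$\beta(\mathrm{W}_E^d(M,N))=\mathrm{V}_{kE}^d(M,N).$$
   Context: Notation: $Q=k[x_1,\dots,x_c]$, $\mathfrak n=(x_1,\dots,x_c)$, $I=(x_1^p,\dots,x_c^p)$, $kE\cong Q/I$, and $V=I/\mathfrak n I$, a $k$-vector space of dimension $c$. Assigning $\deg x_i=1$ makes $kE$ a standard graded $k$-algebra; $kE_1$ is its degree-one component, a $k$-vector space of dimension $c$. For a $k$-vector space $U$ of dimension $c$ with a fixed basis, $\mathrm{G}_d(U)$ is the Grassmann variety of $d$-dimensional subspaces of $U$, embedded in $\mathbb P^{\binom{c}{d}-1}$ by the Plücker embedding with respect to the basis, and $p_W$ is the point corresponding to a $d$-dimensional subspace $W\subseteq U$. Higher-order rank variety: for finitely generated $kE$-modules $M,N$, $$\mathrm{W}_E^d(M,N)=\{p_W\in \mathrm{G}_d(kE_1)\mid \mathrm{Ext}^i_{k[W]}(M,N)\ne 0\text{ for infinitely many } i\},$$ where $k[W]$ is the subalgebra of $kE$ generated by the subspace $W\subseteq kE_1$. Higher-order support variety: $$\mathrm{V}_{kE}^d(M,N)=\{p_W\in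 \mathrm{G}_d(V)\mid \mathrm{Ext}^i_{Q/J}(M,N)\neq 0\text{ for infinitely many } i\},$$ where, for a $d$-dimensional subspace $W\subseteq V$, $J\subseteq I$ is the ideal of $Q$ generated by preimages in $I$ of a basis of $W$ (the condition does not depend on the choices). The map $\beta$: let $\alpha:kE_1\to V$ be given by $\alpha(u)=\widetilde u^{\,p}+\mathfrak n I$, where $\widetilde u\in Q$ is a preimage of $u$; this is a well-defined bijection, additive and satisfying $\alpha(au)=a^p\alpha(u)$ for $a\in k$. Fix a basis of $kE_1$ and take its image under $\alpha$ as the basis of $V$. For a $d$-dimensional subspace $W\subseteq kE_1$, let $\widetilde W^p$ be the ideal of $Q$ generated by the $p$-th powers of linear preimages in $Q$ of a basis of $W$. Then $\beta(p_W)$ is the point of $\mathrm{G}_d(V)$ corresponding to the $d$-dimensional subspace $(\widetilde W^p+\mathfrak n I)/\mathfrak n I$ (which equals $\alpha(W)$). *)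

(* Defs.v *)
From HB Require Import structures.
From mathcomp Require Import all_boot all_order all_algebra all_field.
From mathcomp Require Import ring_quotient generic_quotient.
From mathcomp Require Import boolp classical_sets.
From mathcomp Require Import mpoly.

Set Implicit Arguments.
Unset Strict Implicit.
Unset Printing Implicit Defensive.

Import GRing.Theory.
Local Open Scope ring_scope.
Local Open Scope quotient_scope.

Definition finitely_generated (R : nzRingType) (M : lmodType R) : Prop :=
  exists (n : nat) (g : 'I_n -> M),
    forall x : M, exists a : 'I_n -> R, x = \sum_i a i *: g i.

Definition projective (R : nzRingType) (P : lmodType R) : Prop :=
  forall (A B : lmodType R) (g : {linear A -> B}) (f : {linear P -> B}),
    (forall b, exists a, g a = b) ->
    exists h : {linear P -> A}, forall x, g (h x) = f x.

(* ... -> P_2 -> P_1 -> P_0 -> M -> 0, where [pr_d n : P_(n+1) -> P_n] *)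
Record proj_resolution (R : nzRingType) (M : lmodType R) := ProjResolution {
  pr_mod :> nat -> lmodType R;
  pr_d : forall n, {linear pr_mod n.+1 -> pr_mod n};
  pr_aug : {linear pr_mod 0%N -> M};
  pr_projective : forall n, projective (pr_mod n);
  pr_aug_surj : forall x, exists y, pr_aug y = x;
  pr_exact0 : forall y, pr_aug y = 0 <-> exists z, pr_d 0%N z = y;
  pr_exactS : forall n y, pr_d n y = 0 <-> exists z, pr_d n.+1 z = y
}.

Section Ext.
Variables (R : nzRingType) (M N : lmodType R) (P : proj_resolution M).

Definition cocycle (i : nat) (f : {linear P i -> N}) : Prop :=
  forall x, f (pr_d P i x) = 0.

Definition coboundary (i : nat) : {linear P i -> N} -> Prop :=
  match i with
  | 0 => fun f => forall x, f x = 0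
  | j.+1 => fun f =>
      exists g : {linear P j -> N}, forall x, f x = g (pr_d P j x)
  end.

End Ext.

(* Ext^i_R(M, N) <> 0: the i-th cohomology of Hom_R(P, N) is nonzero for a    *)
(* projective resolution P of M.  By the comparison theorem it is immaterial  *)
(* which resolution is used.                                                  *)
Definition Ext_neq0 (R : nzRingType) (M N : lmodType R) (i : nat) : Prop :=
  exists (P : proj_resolution M) (f : {linear P i -> N}),
    cocycle f /\ ~ coboundary f.

Definition Ext_infinite (R : nzRingType) (M N : lmodType R) : Prop :=
  forall n : nat, exists2 i : nat, (n <= i)%N & Ext_neq0 M N i.

Definition restrict (R S : nzRingType) (f : {rmorphism R -> S})
  (M : lmodType S) : Type := M.

Section Restrict.
Variables (R S : nzRingType) (f : {rmorphism R -> S}) (M : lmodType S).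

HB.instance Definition _ := GRing.Zmodule.on (restrict f M).

Definition restrict_scale (a : R) (x : restrict f M) : restrict f M :=
  f a *: (x : M).

Fact restrict_scaleA a b x :
  restrict_scale a (restrict_scale b x) = restrict_scale (a * b) x.
Proof. by rewrite /restrict_scale rmorphM scalerA. Qed.
Fact restrict_scale1 : left_id 1 restrict_scale.
Proof. by move=> x; rewrite /restrict_scale rmorph1 scale1r. Qed.
Fact restrict_scaleDr : right_distributive restrict_scale +%R.
Proof. by move=> a x y; apply: scalerDr. Qed.
Fact restrict_scaleDl x : {morph restrict_scale^~ x : a b / a + b}.
Proof. by move=> a b; rewrite /restrict_scale rmorphD scalerDl. Qed.

HB.instance Definition _ := GRing.Zmodule_isLmodule.Build R (restrict f M)
  restrict_scaleA restrict_scale1 restrict_scaleDr restrict_scaleDl.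

End Restrict.

Section QuotScale.
Variables (K : nzRingType) (M : lmodType K) (S : zmodClosed M).
Hypothesis S_scale : forall (a : K) (x : M), x \in S -> a *: x \in S.
Local Notation QT := (Quotient.quot S).

Definition quot_scale (a : K) (x : QT) : QT := \pi_QT (a *: repr x).

Lemma quot_piP (x y : M) : reflect (\pi_QT x = \pi_QT y) (x - y \in S).
Proof. by rewrite Quotient.idealrBE; apply: eqP. Qed.

Lemma quot_scale_pi a x : quot_scale a (\pi_QT x) = \pi_QT (a *: x).
Proof.
apply/quot_piP; rewrite -scalerBr; apply: S_scale; apply/quot_piP.
by rewrite reprK.
Qed.

Lemma quot_scaleA a b x :
  quot_scale a (quot_scale b x) = quot_scale (a * b) x.
Proof.
rewrite -[x]reprK [quot_scale b _]quot_scale_pi 2!quot_scale_pi.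
by rewrite scalerA.
Qed.
Lemma quot_scale1 : left_id 1 quot_scale.
Proof. by move=> x; rewrite -[x]reprK quot_scale_pi scale1r. Qed.
Lemma quot_scaleDr : right_distributive quot_scale +%R.
Proof.
move=> a x y; rewrite -[x]reprK -[y]reprK -raddfD 3!quot_scale_pi -raddfD.
by rewrite scalerDr.
Qed.
Lemma quot_scaleDl x : {morph quot_scale^~ x : a b / a + b}.
Proof.
by move=> a b; rewrite -[x]reprK 3!quot_scale_pi -raddfD scalerDl.
Qed.

End QuotScale.

Section Ideal.
Variables (R : comNzRingType).

Definition ideal_of (s : seq R) : {pred R} :=
  fun f => `[< exists a : 'I_(size s) -> R, f = \sum_i a i * s`_i >].

Lemma ideal_ofP s f :
  reflect (exists a : 'I_(size s) -> R, f = \sum_i a i * s`_i)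
          (f \in ideal_of s).
Proof. exact: asboolP. Qed.

Fact ideal_of_zmod_closed s : zmod_closed (ideal_of s).
Proof.
split=> [|f g /ideal_ofP[a ->] /ideal_ofP[b ->]]; apply/ideal_ofP.
  by exists (fun=> 0); rewrite big1 // => i _; rewrite mul0r.
exists (fun i => a i - b i); rewrite -sumrB.
by apply: eq_bigr => i _; rewrite mulrBl.
Qed.
HB.instance Definition _ s := GRing.isZmodClosed.Build R (ideal_of s)
  (ideal_of_zmod_closed s).

Lemma ideal_ofMl s f g : g \in ideal_of s -> f * g \in ideal_of s.
Proof.
move=> /ideal_ofP[a ->]; apply/ideal_ofP; exists (fun i => f * a i).
by rewrite mulr_sumr; apply: eq_bigr => i _; rewrite mulrA.
Qed.

Lemma mem_ideal_of s f : f \in s -> f \in ideal_of s.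
Proof.
move=> sf; apply/ideal_ofP; have ltf : (index f s < size s)%N by rewrite index_mem.
exists (fun i => (i == Ordinal ltf)%:R); rewrite (bigD1 (Ordinal ltf)) //=.
rewrite eqxx mul1r nth_index // big1 ?addr0 // => i /negPf ->.
by rewrite mul0r.
Qed.

Lemma ideal_of_sub s (A : {pred R}) : zmod_closed A ->
    (forall f g, g \in A -> f * g \in A) -> {subset s <= A} ->
  {subset ideal_of s <= A}.
Proof.
move=> [A0 AB] AM sA _ /ideal_ofP[a ->]; elim/big_ind: _ => // [x y Ax Ay|i _].
  by rewrite -[y]opprK; apply: (AB) => //; rewrite -sub0r; apply: (AB).
by apply/AM/sA/mem_nth.
Qed.

End Ideal.

Section Polynomial.
Variables (k : fieldType) (c : nat).
Local Notation Q := {mpoly k[c]}.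

Lemma mcoeffMX_eq0 (f : Q) (m m' : 'X_{1..c}) :
  ~~ (m' <= m)%MM -> (f * 'X_[m'])@_m = 0.
Proof.
move=> lem; rewrite [f]mpolyE mulr_suml raddf_sum /= big1 // => i _.
rewrite -scalerAl -mpolyXD mcoeffZ mcoeffX; case: eqP => [im|]; last first.
  by rewrite mulr0.
by case/negP: lem; rewrite -im lem_addl.
Qed.

Lemma leXnU (p : nat) (i : 'I_c) (m : 'X_{1..c}) :
  (U_(i) *+ p <= m)%MM = (p <= m i)%N.
Proof.
apply/mnm_lepP/idP => [/(_ i)|le_p j]; rewrite mulmnE mnm1E.
  by rewrite eqxx mul1n.
by case: eqP => [<-|]; rewrite ?mul1n ?mul0n.
Qed.

Definition maximal_gens : seq Q := [seq 'X_i | i <- enum 'I_c].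

Lemma mem_maximal (m : 'X_{1..c}) :
  m != 0%MM -> 'X_[m] \in ideal_of maximal_gens.
Proof.
move=> m_neq0; have [i mi | m0] := pickP (fun i => m i != 0%N); last first.
  case/eqP: m_neq0; apply/mnmP => i; rewrite mnm0E.
  by apply/eqP; move: (m0 i) => /= /negbFE.
have le1 : (U_(i) <= m)%MM by rewrite lep1mP.
rewrite -(submK le1) mpolyXD; apply/ideal_ofMl/mem_ideal_of.
by apply/mapP; exists i; rewrite ?mem_enum.
Qed.

Lemma maximal_coef0 f : f \in ideal_of maximal_gens -> f@_0%MM = 0.
Proof.
case/ideal_ofP=> a ->; rewrite raddf_sum big1 //= => i _.
have [j _ ->] := mapP (mem_nth 0 (ltn_ord i)).
by rewrite mcoeffMX_eq0 // lep1mP negbK mnm0E.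
Qed.

Section Frobenius.
Variable p : nat.

Definition frobenius_gens : seq Q := [seq 'X_i ^+ p | i <- enum 'I_c].

(* The ideal n I, generated by the products of a generator of n and one of I. *)
Definition nI : {pred Q} :=
  ideal_of [seq f * g | f <- maximal_gens, g <- frobenius_gens].
HB.instance Definition _ := GRing.ZmodClosed.on nI.

Lemma frobenius_coef (f : Q) (m : 'X_{1..c}) :
  f \in ideal_of frobenius_gens -> (forall i, m i < p)%N -> f@_m = 0.
Proof.
case/ideal_ofP=> a -> ltm; rewrite raddf_sum big1 //= => i _.
have [j _ ->] := mapP (mem_nth 0 (ltn_ord i)).
by rewrite mpolyXn mcoeffMX_eq0 // leXnU -ltnNge.
Qed.

Lemma mem_frobenius (f : Q) :
  (forall m : 'X_{1..c}, (forall i, m i < p)%N -> f@_m = 0) ->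
  f \in ideal_of frobenius_gens.
Proof.
move=> f0; rewrite [f]mpolyE big_seq; apply: rpred_sum => m mf.
have [i /negPn | ltm] := pickP (fun i => p <= m i)%N; last first.
  move: mf; rewrite mcoeff_msupp f0 ?eqxx // => i.
  by rewrite ltnNge ltm.
rewrite negbK -leXnU => lem; rewrite -mul_mpolyC -(submK lem) mpolyXD mulrA.
apply/ideal_ofMl/mem_ideal_of; rewrite -mpolyXn.
by apply/mapP; exists i; rewrite ?mem_enum.
Qed.

Lemma nI_sub : {subset nI <= ideal_of frobenius_gens}.
Proof.
apply: ideal_of_sub; first exact: ideal_of_zmod_closed.
  by move=> f g; apply: ideal_ofMl.
by move=> _ /allpairsP[[f g] [_ gI ->]]; apply/ideal_ofMl/mem_ideal_of.
Qed.

Lemma nI_mul f g : f \in ideal_of maximal_gens ->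
  g \in ideal_of frobenius_gens -> f * g \in nI.
Proof.
move=> /ideal_ofP[a ->] /ideal_ofP[b ->]; rewrite mulr_suml.
apply: rpred_sum => i _; rewrite mulr_sumr; apply: rpred_sum => j _.
rewrite mulrACA; apply/ideal_ofMl/mem_ideal_of/allpairsP.
by exists (maximal_gens`_i, frobenius_gens`_j); split; rewrite ?mem_nth.
Qed.

Hypothesis p_gt0 : (0 < p)%N.

Lemma nI_coef f i : f \in nI -> f@_(U_(i) *+ p) = 0.
Proof.
case/ideal_ofP=> a ->; rewrite raddf_sum big1 //= => l _.
have /allpairsP[[u v] [uM vI ->]] := mem_nth 0 (ltn_ord l).
have /mapP[j _ ->] := vI; rewrite mulrA /= mpolyXn.
have [<-|neq_ji] := eqVneq j i; last first.
  rewrite mcoeffMX_eq0 // leXnU mulmnE mnm1E eq_sym (negPf neq_ji) mul0n.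
  by rewrite -ltnNge.
have := mcoeffMX (a l * u) (U_(j) *+ p)%MM 0%MM; rewrite addm0 => ->.
by apply/maximal_coef0/ideal_ofMl/mem_ideal_of.
Qed.

Lemma mem_nI f : f \in ideal_of frobenius_gens ->
  (forall i, f@_(U_(i) *+ p) = 0) -> f \in nI.
Proof.
move=> fI f0; rewrite [f]mpolyE big_seq; apply: rpred_sum => m mf.
have [i lem | ltm] := pickP (fun i => p <= m i)%N; last first.
  move: mf; rewrite mcoeff_msupp (frobenius_coef fI) ?eqxx // => i.
  by rewrite ltnNge ltm.
move: lem; rewrite /= -leXnU => lem.
rewrite -mul_mpolyC -(submK lem) mpolyXD; apply: ideal_ofMl.
apply: nI_mul; last first.
  by rewrite -mpolyXn; apply/mem_ideal_of/mapP; exists i; rewrite ?mem_enum.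
apply: mem_maximal; apply: contraTneq mf => m0.
by rewrite mcoeff_msupp negbK -(submK lem) m0 add0m f0.
Qed.

End Frobenius.

End Polynomial.

Section GroupAlgebra.
Variables (k : fieldType) (p : nat) (char_k : p \in [pchar k]) (c : nat).
Local Notation Q := {mpoly k[c]}.

Definition frobenius_ideal of p \in [pchar k] : {pred Q} :=
  ideal_of (@frobenius_gens k c p).
Local Notation I := (frobenius_ideal char_k).

HB.instance Definition _ := GRing.ZmodClosed.on I.

Let p_gt0 : (0 < p)%N.
Proof. exact/prime_gt0/(pcharf_prime char_k). Qed.

Fact frobenius_ideal_proper :
  1 \notin I /\ forall f, {in I, forall g, f * g \in I}.
Proof.
split=> [|f g]; last exact: ideal_ofMl.
apply/negP => I1; have := frobenius_coef (m := 0%MM) I1.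
rewrite mcoeff1 eqxx => /(_ _)/eqP; rewrite oner_eq0 => H.
by apply/notF/H => i; rewrite mnm0E.
Qed.
HB.instance Definition _ := isProperIdeal.Build Q I frobenius_ideal_proper.

Fact frobenius_ideal_scale (a : k) f : f \in I -> a *: f \in I.
Proof. by rewrite -mul_mpolyC; apply: ideal_ofMl. Qed.

(* The group algebra of an elementary abelian p-group of rank c: the class of *)
(* x_i stands for g_i - 1, where g_1, ..., g_c are generators of the group.   *)
Definition kE : Type := {ideal_quot I}.
HB.instance Definition _ := GRing.ComNzRing.on kE.
HB.instance Definition _ := GRing.Zmodule_isLmodule.Build k kE
  (quot_scaleA frobenius_ideal_scale) (quot_scale1 frobenius_ideal_scale)
  (quot_scaleDr frobenius_ideal_scale) (quot_scaleDl frobenius_ideal_scale).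

Definition kE_of (f : Q) : kE := \pi_{ideal_quot I} f.

Lemma kE_ofP f g : reflect (kE_of f = kE_of g) (f - g \in I).
Proof. exact: quot_piP. Qed.

Lemma kE_ofK (x : kE) : kE_of (repr (x : {ideal_quot I})) = x.
Proof. exact: reprK. Qed.

HB.instance Definition _ := GRing.RMorphism.copy kE_of (\pi_{ideal_quot I}).

Fact kE_of_scalable : scalable kE_of.
Proof. by move=> a f; rewrite [RHS](quot_scale_pi frobenius_ideal_scale). Qed.
HB.instance Definition _ := GRing.isScalable.Build k Q kE *:%R kE_of
  kE_of_scalable.

Fact kE_scaleAl (a : k) (x y : kE) : a *: (x * y) = (a *: x) * y.
Proof.
rewrite -[x]kE_ofK -[y]kE_ofK -rmorphM -!kE_of_scalable -rmorphM.
by rewrite scalerAl.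
Qed.
HB.instance Definition _ := GRing.Lmodule_isLalgebra.Build k kE kE_scaleAl.
HB.instance Definition _ := GRing.Lalgebra_isComAlgebra.Build k kE.

(* the monomials of degree < p in each variable form a basis of kE *)
Local Notation dimE := #|{ffun 'I_c -> 'I_p}|.
Let exponent (i : 'I_dimE) : 'X_{1..c} :=
  [multinom (enum_val i j : nat) | j < c].
Let coefs (f : Q) : 'rV[k]_dimE := \row_i f@_(exponent i).

Fact coefs_eq0 f : (coefs f == 0) = (f \in I).
Proof.
apply/eqP/idP => [/rowP f0 | fI].
  apply: mem_frobenius => m ltm.
  have := f0 (enum_rank [ffun j => Ordinal (ltm j)]); rewrite !mxE => <-.
  congr (f@_ _); apply/mnmP => j.
  by rewrite mnmE enum_rankK ffunE.
by apply/rowP => i; rewrite !mxE (frobenius_coef fI) // => j; rewrite mnmE.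
Qed.

Fact kE_vector_axiom : Vector.axiom dimE kE.
Proof.
have cB f g : coefs (f - g) = coefs f - coefs g.
  by apply/rowP => i; rewrite !mxE mcoeffB.
have c_pi f : coefs (repr (kE_of f : {ideal_quot I})) = coefs f.
  by apply/eqP; rewrite -subr_eq0 -cB coefs_eq0; apply/kE_ofP; rewrite kE_ofK.
exists (fun x : kE => coefs (repr (x : {ideal_quot I}))).
  move=> a x y; rewrite -{1}[x]kE_ofK -{1}[y]kE_ofK -linearP c_pi.
  by apply/rowP => i; rewrite !mxE mcoeffD mcoeffZ.
exists (fun v : 'rV[k]_dimE => kE_of (\sum_i v 0 i *: 'X_[exponent i])) => [x | v].
  rewrite -[RHS]kE_ofK; apply/kE_ofP; rewrite -coefs_eq0 cB subr_eq0.
  set f := repr _; apply/eqP/rowP => i; rewrite !mxE raddf_sum /=.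
  rewrite (bigD1 i) //= mcoeffZ mcoeffX eqxx mulr1 mxE big1 ?addr0 // => j ji.
  rewrite mcoeffZ mcoeffX; case: eqP => [/mnmP e|]; rewrite ?mulr0 //.
  case/eqP: ji; apply: enum_val_inj; apply/ffunP => l; apply: val_inj.
  by have := e l; rewrite !mnmE.
rewrite c_pi; apply/rowP => i; rewrite !mxE raddf_sum /=.
rewrite (bigD1 i) //= mcoeffZ mcoeffX eqxx mulr1 big1 ?addr0 // => j ji.
rewrite mcoeffZ mcoeffX; case: eqP => [/mnmP e|]; rewrite ?mulr0 //.
case/eqP: ji; apply: enum_val_inj; apply/ffunP => l; apply: val_inj.
by have := e l; rewrite !mnmE.
Qed.
HB.instance Definition _ := Lmodule_hasFinDim.Build k kE kE_vector_axiom.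
HB.instance Definition _ := Algebra_isFalgebra.Build k kE.

(* The degree-one component of kE: I is generated in degree p > 1, so this is *)
(* the image of the space of linear forms.                                    *)
Definition kE1 : {vspace kE} := <<[seq kE_of 'X_i | i <- enum 'I_c]>>%VS.

End GroupAlgebra.

Arguments kE_of {k p} char_k {c} f.
Arguments kE1 {k p} char_k c.

Section Subalgebra.
Variables (K : fieldType) (aT : falgType K) (W : {vspace aT}).

Definition subalgebra : falgType K := subvs_of <<W>>%AS.

Definition subalgebra_val : subalgebra -> aT := vsval.

Fact subalgebra_val_zmod_morphism : zmod_morphism subalgebra_val.
Proof. exact: raddfB. Qed.
Fact subalgebra_val_monoid_morphism : monoid_morphism subalgebra_val.
Proof.
split=> //; apply/eqP; rewrite algid_eq1.
by rewrite memvE /= agenvEl addvSl.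
Qed.
HB.instance Definition _ :=
  GRing.isZmodMorphism.Build subalgebra aT subalgebra_val
    subalgebra_val_zmod_morphism.
HB.instance Definition _ :=
  GRing.isMonoidMorphism.Build subalgebra aT subalgebra_val
    subalgebra_val_monoid_morphism.

End Subalgebra.

Section QuotientSpace.
Variables (k : fieldType) (p : nat) (char_k : p \in [pchar k]) (c : nat).
Local Notation Q := {mpoly k[c]}.
Local Notation I := (@frobenius_ideal k p c char_k).
Local Notation kE := (@kE k p char_k c).

Let p_gt0 : (0 < p)%N.
Proof. exact/prime_gt0/(pcharf_prime char_k). Qed.

HB.instance Definition _ :=
  GRing.isScaleClosed.Build k Q I (@frobenius_ideal_scale k p char_k c).

Inductive frobenius_elt : predArgType :=
  FrobeniusElt (f : Q) & f \in I.
Definition frobenius_val (u : frobenius_elt) : Q :=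
  let: FrobeniusElt f _ := u in f.
HB.instance Definition _ := [isSub for frobenius_val].
HB.instance Definition _ := [Choice of frobenius_elt by <:].
HB.instance Definition _ := [SubChoice_isSubLmodule of frobenius_elt by <:].

Definition nI_in_I : {pred frobenius_elt} := fun u => val u \in @nI k c p.

Fact nI_in_IE u : (u \in nI_in_I) = (val u \in @nI k c p).
Proof. by []. Qed.

Fact nI_in_I_zmod_closed : zmod_closed nI_in_I.
Proof.
split=> [|u v]; rewrite !nI_in_IE ?raddf0 ?raddfB; first exact: rpred0.
exact: rpredB.
Qed.
HB.instance Definition _ := GRing.isZmodClosed.Build frobenius_elt nI_in_I
  nI_in_I_zmod_closed.

Fact nI_in_I_scale (a : k) u : u \in nI_in_I -> a *: u \in nI_in_I.
Proof. by rewrite !nI_in_IE linearZ /= -mul_mpolyC; apply: ideal_ofMl. Qed.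

(* V = I / n I *)
Definition V : Type := Quotient.quot nI_in_I.
HB.instance Definition _ := GRing.Zmodule.on V.
HB.instance Definition _ := GRing.Zmodule_isLmodule.Build k V
  (quot_scaleA nI_in_I_scale) (quot_scale1 nI_in_I_scale)
  (quot_scaleDr nI_in_I_scale) (quot_scaleDl nI_in_I_scale).

Definition V_class (u : frobenius_elt) : V := \pi_(Quotient.quot nI_in_I) u.
Definition V_repr (v : V) : frobenius_elt :=
  repr (v : Quotient.quot nI_in_I).

Lemma V_classP u v :
  reflect (V_class u = V_class v) (val u - val v \in @nI k c p).
Proof. by rewrite -raddfB; apply: quot_piP. Qed.

Lemma V_reprK (v : V) : V_class (V_repr v) = v.
Proof. exact: reprK. Qed.

HB.instance Definition _ :=
  GRing.Additive.copy V_class (\pi_(Quotient.quot nI_in_I)).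
Fact V_class_scalable : scalable V_class.
Proof. by move=> a u; rewrite [RHS](quot_scale_pi nI_in_I_scale). Qed.
HB.instance Definition _ := GRing.isScalable.Build k frobenius_elt V *:%R
  V_class V_class_scalable.

(* The coordinates of the class of f with respect to the classes of x_i^p. *)
Definition V_coef (v : V) : 'rV[k]_c :=
  \row_i (val (V_repr v))@_(U_(i) *+ p).

(* The preimage in I of v which is a k-linear combination of the x_i^p. *)
Definition V_lift (v : V) : Q := \sum_i V_coef v 0 i *: 'X_i ^+ p.

Fact lift_subproof (a : 'rV[k]_c) : \sum_i a 0 i *: 'X_i ^+ p \in I.
Proof.
apply: rpred_sum => i _; rewrite -mul_mpolyC; apply/ideal_ofMl/mem_ideal_of.
by apply/mapP; exists i; rewrite ?mem_enum.
Qed.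

Fact lift_coef (a : 'rV[k]_c) i :
  (\sum_j a 0 j *: 'X_j ^+ p)@_(U_(i) *+ p) = a 0 i.
Proof.
rewrite raddf_sum (bigD1 i) //= mpolyXn mcoeffZ mcoeffX eqxx mulr1.
rewrite big1 ?addr0 // => j ji; rewrite mpolyXn mcoeffZ mcoeffX.
case: eqP => [/mnmP/(_ i)|]; rewrite ?mulr0 //.
rewrite !mulmnE !mnm1E eqxx (negPf ji) mul1n mul0n => p0.
by have := p_gt0; rewrite -p0.
Qed.

Lemma V_liftK (v : V) : V_class (FrobeniusElt (lift_subproof (V_coef v))) = v.
Proof.
rewrite -[RHS]V_reprK; apply/V_classP; apply: mem_nI.
  by apply: rpredB; [apply: lift_subproof | apply: valP].
by move=> i; rewrite mcoeffB [X in X - _]lift_coef mxE subrr.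
Qed.

Fact V_coef_class u i : V_coef (V_class u) 0 i = (val u)@_(U_(i) *+ p).
Proof.
apply/eqP; rewrite mxE -subr_eq0 -mcoeffB; apply/eqP/(nI_coef p_gt0).
by apply/V_classP; rewrite V_reprK.
Qed.

Fact V_vector_axiom : Vector.axiom c V.
Proof.
exists V_coef.
  move=> a x y; rewrite -{1}[x]V_reprK -{1}[y]V_reprK -linearP.
  apply/rowP => i; rewrite V_coef_class.
have -> : val (a *: V_repr x + V_repr y) =
    a *: val (V_repr x) + val (V_repr y) :> Q by [].
by rewrite mcoeffD mcoeffZ !mxE.
exists (fun a => V_class (FrobeniusElt (lift_subproof a))); first exact: V_liftK.
by move=> a; apply/rowP => i; rewrite V_coef_class lift_coef.
Qed.
HB.instance Definition _ := Lmodule_hasFinDim.Build k V V_vector_axiom.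

(* The class of the p-th power of a preimage of u in Q.  This power lies in I *)
(* when u is in kE_1, so the default value 0 of [insubd] plays no role there, *)
(* and its class does not depend on the preimage: see [alpha_linear_form].    *)
Definition alpha (u : kE) : V :=
  V_class (insubd (0 : frobenius_elt) (repr (u : {ideal_quot I}) ^+ p)).


Fact alpha_linear_form (a : 'I_c -> k) i :
  V_coef (alpha (kE_of char_k (\sum_j a j *: 'X_j))) 0 i = a i ^+ p.
Proof.
rewrite /alpha; set f := \sum_j _; set g := repr _.
have p_gt1 : (1 < p)%N by apply/prime_gt1/(pcharf_prime char_k).
have charQ : p \in [pchar Q] by rewrite (rmorph_pchar (@mpolyC c k)).
have hI : g - f \in I by apply/kE_ofP; rewrite kE_ofK.
have fp : f ^+ p = \sum_j (\row_j a j ^+ p) 0 j *: 'X_j ^+ p.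
  rewrite -(pFrobenius_autE charQ) rmorph_sum; apply: eq_bigr => j _.
  by rewrite /= pFrobenius_autE exprZn mxE.
have hn : g - f \in ideal_of (@maximal_gens k c).
  case/ideal_ofP: hI => b ->; apply: rpred_sum => j _; apply: ideal_ofMl.
  have [l _ ->] := mapP (mem_nth 0 (ltn_ord j)).
  rewrite -(prednK p_gt0) exprSr; apply/ideal_ofMl/mem_ideal_of.
  by apply/mapP; exists l; rewrite ?mem_enum.
have hp1 : (g - f) ^+ p.-1 \in ideal_of (@frobenius_gens k c p).
  have [q ->] : exists q, p.-1 = q.+1.
    by exists p.-2; rewrite prednK // -ltnS prednK // ltnW.
  by rewrite exprSr; apply: ideal_ofMl.
have hp : (g - f) ^+ p \in @nI k c p.
  rewrite (_ : (g - f) ^+ p = (g - f) * (g - f) ^+ p.-1); first exact: nI_mul.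
  by rewrite -exprS prednK.
have gp : g ^+ p = f ^+ p + (g - f) ^+ p.
  by rewrite -!(pFrobenius_autE charQ) -rmorphD addrC subrK.
have gI : g ^+ p \in I.
  by rewrite gp fp; apply: rpredD; [apply: lift_subproof | apply: nI_sub].
rewrite V_coef_class insubdK // gp mcoeffD (nI_coef p_gt0 _ hp) addr0 fp.
by rewrite lift_coef mxE.
Qed.

(* The span of the image of a basis of W: this is the subspace                *)
(* (W~^p + n I) / n I of V, since n (I / n I) = 0, and it equals alpha(W)     *)
(* when k is perfect.                                                         *)
Definition alpha_space (W : {vspace kE}) : {vspace V} :=
  <<[seq alpha u | u <- vbasis W]>>%VS.

(* The ideal J of Q generated by preimages in I of a basis of W.  Whether     *)
(* Ext over Q / J is nonzero in infinitely many degrees does not depend on    *)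
(* the preimages; those fixed here are the k-linear combinations of the       *)
(* x_i^p.                                                                     *)
Definition lift_ideal (W : {vspace V}) : {pred Q} :=
  ideal_of [seq V_lift v | v <- vbasis W].
HB.instance Definition _ W := GRing.ZmodClosed.on (lift_ideal W).

Fact lift_ideal_sub W : {subset lift_ideal W <= I}.
Proof.
apply: ideal_of_sub; first exact: ideal_of_zmod_closed.
  by move=> f g; apply: ideal_ofMl.
by move=> _ /mapP[v _ ->]; apply: lift_subproof.
Qed.

Fact lift_ideal_proper W :
  1 \notin lift_ideal W /\
  forall f, {in lift_ideal W, forall g, f * g \in lift_ideal W}.
Proof.
split=> [|f g]; last exact: ideal_ofMl.
apply: contra (@lift_ideal_sub W 1) _.
by have [] := @frobenius_ideal_proper k p char_k c.
Qed.
HB.instance Definition _ W :=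
  isProperIdeal.Build Q (lift_ideal W) (lift_ideal_proper W).

Definition QJ (W : {vspace V}) : comNzRingType := {ideal_quot lift_ideal W}.

Definition QJ_to_kE (W : {vspace V}) (x : QJ W) : kE :=
  kE_of char_k (repr (x : {ideal_quot lift_ideal W})).

Lemma QJ_to_kE_pi W (f : Q) :
  @QJ_to_kE W (\pi_{ideal_quot lift_ideal W} f) = kE_of char_k f.
Proof. by apply/kE_ofP/(@lift_ideal_sub W)/quot_piP; rewrite reprK. Qed.

Fact QJ_to_kE_zmod_morphism W : zmod_morphism (@QJ_to_kE W).
Proof.
move=> x y; rewrite -[x]reprK -[y]reprK -raddfB !QJ_to_kE_pi.
exact: raddfB.
Qed.
Fact QJ_to_kE_monoid_morphism W : monoid_morphism (@QJ_to_kE W).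
Proof.
split=> [|x y].
  by rewrite -(rmorph1 (\pi_{ideal_quot lift_ideal W})) QJ_to_kE_pi rmorph1.
rewrite -[x]reprK -[y]reprK -rmorphM !QJ_to_kE_pi.
exact: rmorphM.
Qed.
HB.instance Definition _ W := GRing.isZmodMorphism.Build (QJ W) kE
  (@QJ_to_kE W) (@QJ_to_kE_zmod_morphism W).
HB.instance Definition _ W := GRing.isMonoidMorphism.Build (QJ W) kE
  (@QJ_to_kE W) (@QJ_to_kE_monoid_morphism W).

End QuotientSpace.

Section Grassmannian.
Variables (k : fieldType) (vT : vectType k) (c d : nat) (e : c.-tuple vT).

Definition minor_index := {S : {set 'I_c} | #|S| == d}.

(* The points of the projective space of dimension 'C(c, d) - 1 are the lines *)
(* of this space of dimension 'C(c, d).                                       *)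
Definition plucker_space : vectType k := {ffun minor_index -> k^o}.

Definition minor_column (S : minor_index) (j : 'I_d) : 'I_c :=
  enum_val (cast_ord (esym (eqP (valP S))) j).

(* The maximal minors of the matrix of coordinates, with respect to e, of a   *)
(* basis of W.                                                                *)
Definition plucker (W : {vspace vT}) : plucker_space :=
  [ffun S : minor_index =>
    \det (\matrix_(i < d, j < d) coord e (minor_column S j) (vbasis W)`_i)].

Definition plucker_point (W : {vspace vT}) : {vspace plucker_space} :=
  <[plucker W]>%VS.

End Grassmannian.

Section Varieties.
Variables (k : fieldType) (p : nat) (char_k : p \in [pchar k]) (c d : nat).
Local Notation kE := (kE char_k c).
Local Notation V := (V char_k c).
Local Notation point := (@plucker_point k _ c d).

Definition rank_variety (e : c.-tuple kE) (M N : lmodType kE) :=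
  [set x | exists W : {vspace kE},
    [/\ (W <= kE1 char_k c)%VS, \dim W = d, x = point e W &
        Ext_infinite (restrict (subalgebra_val (W := W)) M)
                     (restrict (subalgebra_val (W := W)) N)]]%classic.

Definition support_variety (e : c.-tuple V) (M N : lmodType kE) :=
  [set x | exists W : {vspace V},
    [/\ \dim W = d, x = point e W &
        Ext_infinite (restrict (@QJ_to_kE k p char_k c W) M)
                     (restrict (@QJ_to_kE k p char_k c W) N)]]%classic.

(* The d-dimensional subspace W of kE_1 such that x = p_W (W is determined by *)
(* its Pluecker coordinates); the default value 0 is returned when x is not   *)
(* in G_d(kE_1).                                                              *)
Definition subspace_of_point (e : c.-tuple kE)
    (x : {vspace plucker_space k c d}) : {vspace kE} :=
  xget 0%VS [set W : {vspace kE} |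
    [/\ (W <= kE1 char_k c)%VS, \dim W = d & x = point e W]]%classic.

Definition beta (e : c.-tuple kE) (x : {vspace plucker_space k c d}) :
    {vspace plucker_space k c d} :=
  point (map_tuple (@alpha k p char_k c) e)
    (alpha_space (subspace_of_point e x)).

End Varieties.

Arguments rank_variety {k p char_k c} d e M N.
Arguments support_variety {k p char_k c} d e M N.
Arguments beta {k p char_k c} d e x.
Arguments alpha {k p char_k c} u.

(* Main.v *)
From HB Require Import structures.
From mathcomp Require Import functions.
From mathcomp Require finmap monalg.
Require Import Defs.
From mathcomp Require Import all_boot all_order all_algebra all_field.
From mathcomp Require Import ring_quotient generic_quotient.
From mathcomp Require Import boolp classical_sets.
From mathcomp Require Import perm mpoly.

(** Choose a basis w_1, ..., w_d of W and extend it to a basis w_1, ..., w_d,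
    y_1, ..., y_(c-d) of the linear forms.  In the lifted coordinates of Q the
    ideal generated by the w_j^p corresponds to alpha(W), so that, with
    A = k[w_1, ..., w_d]/(w_1^p, ..., w_d^p), the subalgebra k[W] is A itself
    and Q/J is the polynomial ring A[y_1, ..., y_(c-d)].  Both act on M and N
    through kE, where every y_l^p is zero.  Hence the theorem reduces to one
    variable: for a ring A and A[X]-modules M, N killed by a power of X,
    Ext_A(M, N) and Ext_(A[X])(M, N) are nonzero in infinitely many degrees
    simultaneously ([Ext_infinite_poly]).

    For this, take a projective resolution F of M over A[X].  It stays
    projective over A ([poly_projective]), and the operator
    theta f = X f - f X on Hom_A(F_i, N) has kernel Hom_(A[X])(F_i, N) and is
    surjective ([theta_surj]).  The long exact sequence of
    0 -> Hom_(A[X])(F, N) -> Hom_A(F, N) -> Hom_A(F, N) -> 0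
    shows that Ext_(A[X])^(i+1) <> 0 forces Ext_A^i or Ext_A^(i+1) to be
    nonzero.  It also shows that Ext_(A[X])^i = 0 makes theta injective on
    Ext_A^i; but theta is nilpotent there, as it is the difference of the
    commuting actions of X on N and on M, which are nilpotent, so Ext_A^i = 0.
    The action of X^p on F lifts the zero map of M, so it is nullhomotopic;
    this is where the comparison of resolutions is needed.

    Iterating ([Ext_infinite_tower]) and transporting along the isomorphisms
    of k[W] with A and of Q/J with the iterated polynomial ring gives
    [Ext_infinite_subalgebra_quotient].  These isomorphisms come from universal
    properties: in each case there are ring morphisms in both directions, and
    their composites fix the generators.

    It remains to see that beta is the map W |-> alpha(W) on subspaces.  A
    subspace is determined by its Pluecker point ([plucker_point_inj]), and,
    as k is perfect, the p-semilinear bijection alpha puts the subspaces of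
    kE_1 and of V in a bijection that preserves dimension ([dim_alpha_space],
    [alpha_space_surj]). *)

Set Implicit Arguments.
Unset Strict Implicit.
Unset Printing Implicit Defensive.

Import GRing.Theory.
Local Open Scope ring_scope.
Local Open Scope quotient_scope.

(** * Projective resolutions and their comparison *)

Definition mk_linear (R : nzRingType) (U V : lmodType R) (f : U -> V)
    (f_lin : linear f) : {linear U -> V} :=
  HB.pack f (GRing.isLinear.Build R U V *:%R f f_lin).

Section Kernel.
Variables (R : nzRingType) (U V : lmodType R) (f : {linear U -> V}).

Definition in_ker : {pred U} := fun x => f x == 0.

Fact in_ker_submod : submod_closed in_ker.
Proof.
split=> [|a x y]; rewrite !unfold_in; first by rewrite linear0.
by move=> /eqP fx /eqP fy; rewrite linearP fx fy scaler0 addr0.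
Qed.
HB.instance Definition _ := GRing.isSubmodClosed.Build R U in_ker in_ker_submod.

(** The kernel has to be a module in its own right, because [projective] lifts
    only against maps that are surjective onto a whole module. *)
Inductive ker_elt : predArgType := KerElt (x : U) & x \in in_ker.
Definition ker_val (u : ker_elt) : U := let: KerElt x _ := u in x.
HB.instance Definition _ := [isSub for ker_val].
HB.instance Definition _ := [Choice of ker_elt by <:].
HB.instance Definition _ := [SubChoice_isSubLmodule of ker_elt by <:].

End Kernel.

Lemma projective_lift (R : nzRingType) (P A B C : lmodType R)
    (u : {linear A -> B}) (v : {linear B -> C}) (f : {linear P -> B}) :
    projective P -> (forall y, v y = 0 -> exists z, u z = y) ->
    (forall y, v (u y) = 0) -> (forall x, v (f x) = 0) ->
  exists h : {linear P -> A}, forall x, u (h x) = f x.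
Proof.
move=> projP ex vu0 vf0.
have uK y : u y \in in_ker v by apply/eqP/vu0.
have fK x : f x \in in_ker v by apply/eqP/vf0.
have u_lin : linear (fun y => KerElt (uK y)).
  by move=> a x y; apply: val_inj; rewrite /= linearP.
have f_lin : linear (fun x => KerElt (fK x)).
  by move=> a x y; apply: val_inj; rewrite /= linearP.
have surj b : exists a, mk_linear u_lin a = b.
  case: b => y yK; have /eqP/ex[z uz] := yK.
  by exists z; apply: val_inj; rewrite /= uz.
have [h hE] := projP _ _ (mk_linear u_lin) (mk_linear f_lin) surj.
by exists h => x; have /(congr1 val) := hE x.
Qed.

Section Resolutions.
Variable R : nzRingType.

Lemma pr_dd (M : lmodType R) (P : proj_resolution M) n x :
  pr_d P n (pr_d P n.+1 x) = 0.
Proof. by apply/pr_exactS; exists x. Qed.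

Lemma pr_augd (M : lmodType R) (P : proj_resolution M) x :
  pr_aug P (pr_d P 0%N x) = 0.
Proof. by apply/pr_exact0; exists x. Qed.

Lemma lift_boundary0 (M Q : lmodType R) (F : proj_resolution M)
    (f : {linear Q -> F 0%N}) :
    projective Q -> (forall x, pr_aug F (f x) = 0) ->
  exists h : {linear Q -> F 1%N}, forall x, pr_d F 0%N (h x) = f x.
Proof.
move=> projQ; apply: projective_lift => // y; last exact: pr_augd.
by move/pr_exact0.
Qed.

Lemma lift_boundaryS (M Q : lmodType R) (F : proj_resolution M) n
    (f : {linear Q -> F n.+1}) :
    projective Q -> (forall x, pr_d F n (f x) = 0) ->
  exists h : {linear Q -> F n.+2}, forall x, pr_d F n.+1 (h x) = f x.
Proof.
move=> projQ; apply: projective_lift => // y; last exact: pr_dd.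
by move/pr_exactS.
Qed.

Section Comparison.
Variables (M : lmodType R) (P F : proj_resolution M).

(** The comparison theorem.  Consecutive components are constructed in pairs,
    so that each step of the recursion remembers the commuting square from
    which the next lift starts. *)
Lemma chain_map_exists :
  exists u : forall n, {linear P n -> F n},
    (forall x, pr_aug F (u 0%N x) = pr_aug P x) /\
    (forall n x, pr_d F n (u n.+1 x) = u n (pr_d P n x)).
Proof.
have [u0 u0E] := pr_projective (p := P) (n := 0%N) (pr_aug P)
  (@pr_aug_surj _ _ F).
have [u1 u1E] : exists h : {linear P 1%N -> F 0%N.+1},
    forall x, pr_d F 0%N (h x) = (u0 \o pr_d P 0%N) x.
  apply: lift_boundary0 => [|x]; first exact: pr_projective.
  by rewrite /= u0E pr_augd.
pose T n := {uv : {linear P n -> F n} * {linear P n.+1 -> F n.+1} |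
             forall x, pr_d F n (uv.2 x) = uv.1 (pr_d P n x)}.
have step n (t : T n) : {t' : T n.+1 | (sval t').1 = (sval t).2}.
  case: t => -[a b] /= abE; apply: cid.
  have [h hE] : exists h : {linear P n.+2 -> F n.+2},
      forall x, pr_d F n.+1 (h x) = (b \o pr_d P n.+1) x.
    apply: lift_boundaryS => [|x]; first exact: pr_projective.
    by rewrite /= abE pr_dd linear0.
  by unshelve eexists; first by exists (b, h).
have t0 : {t : T 0%N | (sval t).1 = u0}.
  by unshelve eexists; first by exists (u0, u1).
pose t := fix t n : T n :=
  if n is n'.+1 then sval (step n' (t n')) else sval t0.
exists (fun n => (sval (t n)).1); split=> [x|n x].
  by rewrite /= (svalP t0) u0E.
rewrite /= (svalP (step n (t n))); exact: (svalP (t n)).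
Qed.

(** The homotopy is built degree by degree, s_(n+1) being a lift of
    h_(n+1) - s_n d.  Only the relation d s_n d = h_n d is carried along, since
    it makes the next lift possible whatever s_(n-1) was. *)
Lemma null_homotopy_step (h : forall n, {linear P n -> F n}) :
    (forall x, pr_aug F (h 0%N x) = 0) ->
    (forall n x, pr_d F n (h n.+1 x) = h n (pr_d P n x)) ->
    forall n, exists s : {linear P n -> F n.+1},
      forall x, pr_d F n (s (pr_d P n x)) = h n (pr_d P n x).
Proof.
move=> h0 hd; elim=> [|n [s sE]].
  have [s sE] := lift_boundary0 (@pr_projective _ _ P 0%N) h0.
  by exists s => x; rewrite sE.
have eq0 x : pr_d F n ((h n.+1 \- (s \o pr_d P n)) x) = 0.
  by rewrite /= linearB /= hd sE subrr.
have [s' s'E] := lift_boundaryS (@pr_projective _ _ P n.+1) eq0.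
by exists s' => x; rewrite s'E /= pr_dd linear0 subr0.
Qed.

Lemma null_homotopy0 (h : forall n, {linear P n -> F n}) :
    (forall x, pr_aug F (h 0%N x) = 0) ->
  exists s : {linear P 0%N -> F 1%N}, forall x, h 0%N x = pr_d F 0%N (s x).
Proof.
move=> h0.
have [s sE] := lift_boundary0 (@pr_projective _ _ P 0%N) h0.
by exists s => x; rewrite sE.
Qed.

Lemma null_homotopyS (h : forall n, {linear P n -> F n}) n :
    (forall x, pr_aug F (h 0%N x) = 0) ->
    (forall n x, pr_d F n (h n.+1 x) = h n (pr_d P n x)) ->
  exists (s' : {linear P n.+1 -> F n.+2}) (s : {linear P n -> F n.+1}),
    forall x, h n.+1 x = pr_d F n.+1 (s' x) + s (pr_d P n x).
Proof.
move=> h0 hd; have [s sE] := null_homotopy_step h0 hd n.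
have eq0 x : pr_d F n ((h n.+1 \- (s \o pr_d P n)) x) = 0.
  by rewrite /= linearB /= hd sE subrr.
have [s' s'E] := lift_boundaryS (@pr_projective _ _ P n.+1) eq0.
by exists s', s => x; rewrite s'E /= subrK.
Qed.

End Comparison.

Section Cochains.
Variables (M N : lmodType R) (P : proj_resolution M).

(** [coboundary] for bare functions: cochains over a ring and over a ring
    above it are then compared without moving linear structures around. *)
Definition cobounds (i : nat) : (P i -> N) -> Prop :=
  match i with
  | 0 => fun f => forall x, f x = 0
  | j.+1 => fun f =>
      exists g : {linear P j -> N}, forall x, f x = g (pr_d P j x)
  end.

Lemma coboundaryP i (f : {linear P i -> N}) : coboundary f <-> cobounds f.
Proof. by case: i f. Qed.

Lemma cobounds_eq i (f g : P i -> N) : f =1 g -> cobounds f -> cobounds g.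
Proof.
case: i f g => /= [|i] f g fg; first by move=> f0 x; rewrite -fg.
by case=> h fh; exists h => x; rewrite -fg.
Qed.

Lemma coboundsB i (f g : P i -> N) :
  cobounds f -> cobounds g -> cobounds (fun x => f x - g x).
Proof.
case: i f g => /= [|i] f g; first by move=> f0 g0 x; rewrite f0 g0 subrr.
by case=> h fh [h' gh]; exists (h \- h') => x; rewrite /= fh gh.
Qed.

Lemma cobounds0 i : cobounds (fun _ : P i => 0).
Proof. by case: i => //= i; exists \0. Qed.

Lemma coboundsN i (f : P i -> N) : cobounds f -> cobounds (fun x => - f x).
Proof.
move=> fc; apply: cobounds_eq (coboundsB (cobounds0 _) fc) => x; exact: sub0r.
Qed.

Lemma cobounds_d i (f : P i -> N) x : cobounds f -> f (pr_d P i x) = 0.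
Proof.
case: i f x => [|i] f x /=; first by move=> ->.
by case=> g ->; rewrite pr_dd linear0.
Qed.

End Cochains.

(** A chain map over the zero map of M is nullhomotopic, so it kills
    cohomology. *)
Lemma cobounds_homotopic (M N : lmodType R) (P F : proj_resolution M)
    (h : forall n, {linear P n -> F n}) i (f : {linear F i -> N}) :
    (forall x, pr_aug F (h 0%N x) = 0) ->
    (forall n x, pr_d F n (h n.+1 x) = h n (pr_d P n x)) ->
    cocycle f -> cobounds (P := P) (fun x => f (h i x)).
Proof.
move=> h0 hd; case: i f => [|i] f fc /=.
  by have [s sE] := null_homotopy0 h0 => x; rewrite sE fc.
have [s' [s sE]] := null_homotopyS i h0 hd.
by exists (f \o s) => x; rewrite sE linearD fc add0r.
Qed.

Lemma cobounds_chain_map (M N : lmodType R) (P F : proj_resolution M)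
    (u : forall n, {linear P n -> F n}) i (f : F i -> N) :
    (forall n x, pr_d F n (u n.+1 x) = u n (pr_d P n x)) ->
    cobounds f -> cobounds (P := P) (fun x => f (u i x)).
Proof.
move=> ud; case: i f => [|i] f /= => [f0 x //|[g fE]].
by exists (g \o u i) => x; rewrite fE ud.
Qed.

(** Independence of the resolution: with comparison maps u : P -> F and
    v : F -> P, a cocycle f of P differs from f v u by a coboundary. *)
Lemma Ext_neq0_resolution (M N : lmodType R) (F : proj_resolution M) i :
  Ext_neq0 M N i -> exists f : {linear F i -> N}, cocycle f /\ ~ cobounds f.
Proof.
case=> P [f [fc fncob]].
have [u [u0 ud]] := chain_map_exists P F.
have [v [v0 vd]] := chain_map_exists F P.
exists (f \o v i); split=> [x|fcob]; first by rewrite /= -vd fc.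
apply/fncob/coboundaryP.
pose h n := (v n \o u n) \- idfun : {linear P n -> P n}.
have hf : cobounds (P := P) (fun x => f (h i x)).
  apply: cobounds_homotopic => // [x|n x]; first by rewrite /= linearB /= v0 u0 subrr.
  by rewrite /= linearB /= vd ud.
apply: cobounds_eq (coboundsB (cobounds_chain_map ud fcob) hf) => x /=.
by rewrite linearB opprB addrC subrK.
Qed.

Section Free.
Import finmap monalg.
Variables (K : choiceType).

Definition free_ext (A : lmodType R) (v : K -> A) (g : {malg R[K]}) : A :=
  \sum_(k <- msupp g) mcoeff k g *: v k.

Lemma free_extEw (A : lmodType R) (v : K -> A) (D : {fset K}) g :
  (msupp g `<=` D)%fset -> free_ext v g = \sum_(k <- D) mcoeff k g *: v k.
Proof.
move=> le; rewrite [LHS](big_fset_incl _ le) => //= x xd /mcoeff_outdom ->.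
by rewrite scale0r.
Qed.

Lemma free_ext_linear (A : lmodType R) (v : K -> A) : linear (free_ext v).
Proof.
move=> a g1 g2; pose D := (msupp (a *: g1 + g2) `|` (msupp g1 `|` msupp g2))%fset.
have sub3 : (msupp (a *: g1 + g2) `<=` D)%fset by apply: fsubsetUl.
have sub12 : (msupp g1 `|` msupp g2 `<=` D)%fset by apply: fsubsetUr.
have sub1 : (msupp g1 `<=` D)%fset := fsubset_trans (fsubsetUl _ _) sub12.
have sub2 : (msupp g2 `<=` D)%fset := fsubset_trans (fsubsetUr _ _) sub12.
rewrite (free_extEw v sub1) (free_extEw v sub2) (free_extEw v sub3).
rewrite scaler_sumr -big_split /=; apply: eq_bigr => k _.
by rewrite mcoeffD fgscaleE scalerDl scalerA.
Qed.

Lemma free_extU (A : lmodType R) (v : K -> A) k : free_ext v (mkmalgU k 1) = v k.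
Proof.
by rewrite (free_extEw v msuppU_le) big_seq_fset1 mcoeffUU scale1r.
Qed.

(** Lift the images of the basis elements and extend linearly. *)
Lemma free_projective : projective ({malg R[K]} : lmodType R).
Proof.
move=> A B g f surj.
have [v vE] := choice (fun k : K => surj (f (mkmalgU k 1))).
exists (mk_linear (free_ext_linear v)) => x /=.
rewrite /free_ext linear_sum [in RHS](monalgE x) linear_sum; apply: eq_bigr => k _.
rewrite linearZ /= vE -linearZ; congr (f _).
by apply/malgP => k'; rewrite fgscaleE !mcoeffU mulrnAr mulr1.
Qed.

End Free.

Section Cover.
Import finmap monalg.

Definition cover (M : lmodType R) : lmodType R := {malg R[M]}.
Definition cover_map (M : lmodType R) : {linear cover M -> M} :=
  mk_linear (free_ext_linear (id : M -> M)).

Lemma cover_map_surj (M : lmodType R) x : exists y, cover_map M y = x.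
Proof. by exists (monalg.mkmalgU x 1); apply: free_extU. Qed.

End Cover.

(** A map onto which the resolution is to be continued: the next module is the
    free module on the elements of its kernel. *)
Record stage := Stage {
  stage_dom : lmodType R;
  stage_cod : lmodType R;
  stage_map : {linear stage_dom -> stage_cod}
}.

Definition next_stage (T : stage) : stage :=
  Stage ((\val : {linear ker_elt (stage_map T) -> stage_dom T}) \o
         cover_map (ker_elt (stage_map T))).

Definition free_stage (M : lmodType R) n := iter n next_stage (Stage (cover_map M)).

Lemma next_stage_exact T y :
  stage_map T y = 0 <-> exists z, stage_map (next_stage T) z = y.
Proof.
split=> [/eqP Ty|[z <-]]; last first.
  by apply/eqP; apply: (valP (cover_map (ker_elt (stage_map T)) z)).
have [z zE] := cover_map_surj (KerElt Ty).
by exists z; have := congr1 val zE.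
Qed.

Definition free_resolution (M : lmodType R) : proj_resolution M.
Proof.
apply: (@ProjResolution R M (fun n => stage_dom (free_stage M n))
  (fun n => stage_map (free_stage M n.+1)) (cover_map M)).
- by case=> [|n]; apply: free_projective.
- exact: cover_map_surj.
- by move=> y; apply: (@next_stage_exact (Stage (cover_map M))).
- by move=> n y; apply: (@next_stage_exact (free_stage M n.+1)).
Defined.

End Resolutions.

(** * Restriction of scalars and polynomial rings *)

Section RestrictResolution.
Variables (R S : nzRingType) (sigma : {rmorphism R -> S}).

Lemma restrict_scaleE (M : lmodType S) (a : R) (x : restrict sigma M) :
  a *: x = sigma a *: (x : M).
Proof. by []. Qed.

Lemma restrict_linear_subproof (U V : lmodType S) (f : {linear U -> V}) :
  linear (f : restrict sigma U -> restrict sigma V).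
Proof. by move=> a x y; rewrite [LHS]linearP. Qed.

Definition restrict_linear (U V : lmodType S) (f : {linear U -> V}) :
  {linear restrict sigma U -> restrict sigma V} :=
  mk_linear (restrict_linear_subproof f).

Definition restrict_resolution (M : lmodType S) (M' : lmodType R)
    (h : {linear restrict sigma M -> M'}) (h_bij : bijective h)
    (res_proj : forall P : lmodType S, projective P ->
                projective (restrict sigma P : lmodType R))
    (P : proj_resolution M) : proj_resolution M'.
Proof.
apply: (@ProjResolution R M' (fun n => restrict sigma (P n))
  (fun n => restrict_linear (pr_d P n)) (h \o restrict_linear (pr_aug P))).
- by move=> n; apply/res_proj/pr_projective.
- move=> x; have [g _ gK] := h_bij.
  have [y yE] := pr_aug_surj P (g x).
  by exists y; rewrite /= yE gK.
- move=> y; split=> [/= hy|[z <-]]; last by rewrite /= pr_augd linear0.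
  by apply/pr_exact0/(bij_inj h_bij); rewrite hy linear0.
- move=> n y; exact: (@pr_exactS _ _ P n y).
Defined.

End RestrictResolution.

Section IsoRings.
Variables (R S : nzRingType) (sigma : {rmorphism R -> S}).
Variables (tau : {rmorphism S -> R}).
Hypotheses (sigmaK : cancel sigma tau) (tauK : cancel tau sigma).

(** A lifting problem over R becomes one over S by restriction along tau. *)
Lemma iso_projective (P : lmodType S) :
  projective P -> projective (restrict sigma P : lmodType R).
Proof.
move=> projP A B g f surj.
have f_lin : linear (f : P -> restrict tau B).
  move=> a x y; rewrite -{1}[a]tauK.
  exact: (linearP f (tau a) (x : restrict sigma P) y).
have [h hE] := projP _ _ (restrict_linear tau g) (mk_linear f_lin) surj.
have h_lin : linear (h : restrict sigma P -> A).
  move=> a x y; rewrite [LHS](linearP h (sigma a)).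
  by rewrite -{2}[a]sigmaK.
by exists (mk_linear h_lin).
Qed.

Lemma iso_Ext_neq0 (M N : lmodType S) (M' N' : lmodType R)
    (hM : {linear restrict sigma M -> M'}) (hN : {linear restrict sigma N -> N'})
    i : bijective hM -> bijective hN -> Ext_neq0 M N i -> Ext_neq0 M' N' i.
Proof.
move=> hM_bij hN_bij [P [f [fc fncob]]].
exists (restrict_resolution hM_bij iso_projective P).
exists (hN \o restrict_linear sigma f); split=> [x|fcob].
  by rewrite /= fc linear0.
apply: fncob; have [g gK hK] := hN_bij.
case: i f fc fcob => [|i] f fc /= fcob.
  by move=> x; apply: (can_inj gK); rewrite fcob linear0.
have [u uE] := fcob.
have gu_lin : linear (fun x : P i => g (u x) : N).
  move=> a x y; apply: (can_inj gK); rewrite hK.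
  rewrite -[a]tauK [RHS](linearP hN (tau a)) !hK.
  exact: (linearP u (tau a)).
by exists (mk_linear gu_lin) => x; apply: (can_inj gK); rewrite /= hK uE.
Qed.

End IsoRings.

Section PolyModule.
Variables (R : nzRingType) (U : lmodType R) (T : {linear U -> U}).

(** The {poly R}-module carried by U on which the variable acts as T. *)
Definition poly_module of {linear U -> U} : Type := U.
HB.instance Definition _ := GRing.Zmodule.on (poly_module T).

Definition poly_scale (q : {poly R}) (u : poly_module T) : poly_module T :=
  \sum_(i < size q) q`_i *: iter i T (u : U).

(** Summing up to any bound above the degree allows polynomials of different
    degrees to be compared term by term. *)
Lemma poly_scaleEw n (q : {poly R}) u : (size q <= n)%N ->
  poly_scale q u = \sum_(i < n) q`_i *: iter i T (u : U).
Proof.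
move=> le; rewrite /poly_scale (big_ord_widen _ (fun i => q`_i *: iter i T u) le).
rewrite big_mkcond; apply: eq_bigr => i _; case: ltnP => // leq.
by rewrite nth_default // scale0r.
Qed.

Lemma poly_scaleDl u : {morph poly_scale^~ u : q r / q + r}.
Proof.
move=> q r; pose n := maxn (size q) (size r).
rewrite (poly_scaleEw _ (size_polyD q r)).
rewrite (poly_scaleEw (n := n) _ (leq_maxl _ _)).
rewrite (poly_scaleEw (n := n) _ (leq_maxr _ _)) -big_split.
by apply: eq_bigr => i _; rewrite coefD scalerDl.
Qed.

Lemma iter_linear i : linear (iter i T : U -> U).
Proof.
elim: i => //= i IH a x y.
exact: etrans (congr1 T (IH a x y)) (linearP T a _ _).
Qed.

Lemma poly_scaleDr : right_distributive poly_scale +%R.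
Proof.
move=> q u v; rewrite /poly_scale -big_split; apply: eq_bigr => i _ /=.
by rewrite -[X in iter i T (X + _)]scale1r iter_linear scale1r scalerDr.
Qed.

Lemma poly_scaleC c u : poly_scale c%:P u = c *: (u : U).
Proof.
by rewrite (poly_scaleEw _ (size_polyC_leq1 c)) big_ord1 coefC.
Qed.

Lemma poly_scale0 u : poly_scale 0 u = 0.
Proof. by rewrite -(polyC0 R) poly_scaleC scale0r. Qed.

Lemma poly_scaleCM c q u : poly_scale (c%:P * q) u = c *: (poly_scale q u : U).
Proof.
have le : (size (c%:P * q)%R <= size q)%N by rewrite mul_polyC size_scale_leq.
rewrite (poly_scaleEw _ le) scaler_sumr; apply: eq_bigr => i _.
by rewrite coefCM scalerA.
Qed.

Lemma poly_scaleMX q u : poly_scale (q * 'X) u = poly_scale q (T u).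
Proof.
have le : (size (q * 'X)%R <= (size q).+1)%N.
  by apply: leq_trans (size_polyMleq _ _) _; rewrite size_polyX addn2.
rewrite (poly_scaleEw _ le) big_ord_recl coefMX /= scale0r add0r.
by apply: eq_bigr => i _; rewrite coefMX /= -iterSr.
Qed.

Lemma poly_scaleT q u : poly_scale q (T u) = T (poly_scale q u).
Proof.
rewrite /poly_scale linear_sum; apply: eq_bigr => i _.
by rewrite linearZ /= -iterS -iterSr.
Qed.

Lemma poly_scaleA q r u : poly_scale q (poly_scale r u) = poly_scale (q * r) u.
Proof.
elim/poly_ind: q r u => [|q c IH] r u.
  by rewrite mul0r !poly_scale0.
rewrite mulrDl !poly_scaleDl poly_scaleMX -!mulrA -commr_polyX.
by rewrite -IH poly_scaleMX !poly_scaleT poly_scaleC poly_scaleCM. Qed.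

Lemma poly_scale1 : left_id 1 poly_scale.
Proof. by move=> u; rewrite -polyC1 poly_scaleC scale1r. Qed.

HB.instance Definition _ := GRing.Zmodule_isLmodule.Build {poly R} (poly_module T)
  poly_scaleA poly_scale1 poly_scaleDr poly_scaleDl.

Lemma poly_module_scaleC c (u : poly_module T) : c%:P *: u = c *: (u : U).
Proof. exact: poly_scaleC. Qed.

Lemma poly_module_scaleX (u : poly_module T) : 'X *: u = T u.
Proof.
rewrite -['X]mul1r [LHS]poly_scaleMX -polyC1 poly_scaleC.
by rewrite scale1r.
Qed.

End PolyModule.

Section PolyExt.
Variable R : nzRingType.
Local Notation B := {poly R}.
Local Notation res M := (restrict (@polyC R : {rmorphism R -> B}) M).

Lemma poly_linear (U V : lmodType B) (f : {linear res U -> res V}) :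
  (forall x : U, f ('X *: x) = 'X *: (f x : V)) -> linear (f : U -> V).
Proof.
move=> fX; have fZ q x : f (q *: (x : U)) = q *: (f x : V).
  elim/poly_ind: q x => [|q c IH] x; first by rewrite !scale0r linear0.
  rewrite !scalerDl -!scalerA (linearD f) IH fX.
  by congr (_ + _); exact: (linearZZ f c x).
by move=> q x y; rewrite (linearD f) fZ.
Qed.

Section Coinduced.
Variable V : lmodType R.
Definition shift (u : nat -> V) : nat -> V := fun n => u n.+1.
Fact shift_linear : linear shift. Proof. by []. Qed.
(** Hom_R({poly R}, V), an R-linear map being recorded by its values on the
    powers of 'X. *)
Definition coinduced : lmodType B := poly_module (mk_linear shift_linear).
End Coinduced.

(** Restriction of scalars is left adjoint to coinduction, and coinduction
    preserves surjections. *)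
Lemma poly_projective (P : lmodType B) :
  projective P -> projective (res P : lmodType R).
Proof.
move=> projP U V g f surj.
pose ft (x : P) : coinduced V := fun n => f ('X^n *: x).
have ft_lin1 : linear (ft : res P -> res (coinduced V)).
  move=> a x y; rewrite !restrict_scaleE [_ *: (ft x : coinduced V)]poly_module_scaleC.
  apply/funext => n; rewrite /ft scalerDr scalerA -commr_polyXn -scalerA.
  exact: linearP.
have ft_lin : linear ft.
  apply: (@poly_linear _ _ (mk_linear ft_lin1)) => x /=.
  rewrite poly_module_scaleX; apply/funext => n /=.
  by rewrite /ft /shift scalerA -exprSr.
pose gt (u : coinduced U) : coinduced V := fun n => g (u n).
have gt_lin1 : linear (gt : res (coinduced U) -> res (coinduced V)).
  move=> a x y; rewrite !restrict_scaleE !poly_module_scaleC.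
  by apply/funext => n; rewrite /gt linearP.
have gt_lin : linear gt.
  apply: (@poly_linear _ _ (mk_linear gt_lin1)) => x /=.
  by rewrite !poly_module_scaleX.
have gt_surj v : exists u, mk_linear gt_lin u = v.
  have [u uE] := choice (fun n => surj (v n)).
  by exists u; apply/funext.
have [h hE] := projP _ _ (mk_linear gt_lin) (mk_linear ft_lin) gt_surj.
have h_lin : linear (fun x : res P => h x 0%N).
  move=> a x y.
  by rewrite restrict_scaleE linearP /= poly_module_scaleC.
exists (mk_linear h_lin) => x.
have /(congr1 (fun u => u 0%N)) := hE x.
by rewrite /= /gt /ft expr0 scale1r.
Qed.

Section Theta.
Variables (P N : lmodType B).

Definition theta (f : P -> N) (x : P) : N := 'X *: f x - f ('X *: x).

Fact scaleX_linear (U : lmodType B) : linear (fun x : res U => 'X *: (x : U) : res U).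
Proof.
move=> a x y; rewrite !restrict_scaleE scalerDr !scalerA.
by rewrite commr_polyX.
Qed.
Definition scaleX (U : lmodType B) : {linear res U -> res U} :=
  mk_linear (@scaleX_linear U).

(** Given h, make N * P an extension of P by N on which 'X acts by
    (n, x) |-> ('X n - h x, 'X x).  As P is projective the extension splits, and
    the first component f of a splitting satisfies theta f = h. *)
Lemma theta_surj (h : {linear res P -> res N}) : projective P ->
  exists f : {linear res P -> res N}, theta f =1 h.
Proof.
move=> projP.
pose T (u : (res N * res P)%type) : (res N * res P)%type :=
  (scaleX N u.1 - h u.2, scaleX P u.2).
have T_lin : linear T.
  move=> a u v; rewrite /T; congr (_, _); last exact: linearP.
  rewrite [(a *: u + v).1]/= [(a *: u + v).2]/= (linearP (scaleX N)) (linearP h).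
  rewrite [RHS](_ : _ = a *: (scaleX N u.1 - h u.2) + (scaleX N v.1 - h v.2)) //.
  rewrite scalerBr.
  by rewrite opprD addrACA.
pose E := poly_module (mk_linear T_lin).
have snd_lin1 : linear ((fun u => u.2) : res E -> res P).
  by move=> a u v; rewrite restrict_scaleE poly_module_scaleC.
have snd_lin : linear ((fun u => u.2) : E -> P).
  apply: (@poly_linear _ _ (mk_linear snd_lin1)) => x /=.
  by rewrite poly_module_scaleX.
have surj x : exists u, mk_linear snd_lin u = x by exists (0, x).
have [s sE] := projP _ _ (mk_linear snd_lin) idfun surj.
have f_lin : linear ((fun x => (s x).1) : res P -> res N).
  by move=> a x y; rewrite restrict_scaleE linearP poly_module_scaleC.
exists (mk_linear f_lin) => x; rewrite /theta /=.
have := congr1 fst (linearZZ s 'X x); rewrite poly_module_scaleX /= => ->.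
have -> : (s x).2 = x := sE x.
exact: subKr.
Qed.

(** The kernel of theta consists of the maps that commute with 'X. *)
Lemma theta0_linear (f : {linear res P -> res N}) :
  (forall x, theta f x = 0) -> linear (f : P -> N).
Proof.
by move=> f0; apply: poly_linear => x; apply/esym/eqP; rewrite -subr_eq0; exact/eqP/(f0 x).
Qed.

End Theta.

Section Transfer.
Variables (M N : lmodType B) (F : proj_resolution M).

Fact idres_linear : linear (id : res M -> res M). Proof. by []. Qed.

Definition restrictF : proj_resolution (res M : lmodType R) :=
  restrict_resolution (h := mk_linear idres_linear)
    (Bijective (fun _ => erefl) (fun _ => erefl)) poly_projective F.

Implicit Type i : nat.

Lemma cobounds_restrict i (f : F i -> N) : cobounds f -> cobounds (P := restrictF) (N := res N) f.
Proof.
by case: i f => [|i] f //= [g gE]; exists (restrict_linear _ g).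
Qed.

(** If theta f = g d with g = theta g', then f - g' d is killed by theta, hence
    linear over the polynomial ring: this is the exactness of the long exact
    sequence at H^i(Hom_R(F, N)). *)
Lemma theta_cobounds i (f : {linear res (F i) -> res N}) :
    cobounds (P := restrictF) (N := res N) (theta f) ->
  exists g : {linear F i -> N},
    cobounds (P := restrictF) (N := res N) (fun x => f x - g x).
Proof.
case: i f => [|i] f /=.
  by move=> f0; exists (mk_linear (theta0_linear f0)) => x; apply: subrr.
case=> g gE; have [g' g'E] := theta_surj g (@pr_projective _ _ F i).
pose f' := f \- (g' \o restrict_linear _ (pr_d F i)) :
  {linear res (F i.+1) -> res N}.
have f'0 x : theta f' x = 0.
  have := gE x; rewrite /= -g'E /theta -(linearZZ (pr_d F i) 'X x) => fE.
  have sub2 (V : zmodType) (u v w z : V) : u - v = w - z -> u - w - (v - z) = 0.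
    move/eqP; rewrite subr_eq => /eqP ->.
    by rewrite -[w - z + v]addrA [_ - w]addrAC subrr add0r [- z + v]addrC subrr.
  by rewrite /= scalerBr; apply: sub2.
by exists (mk_linear (theta0_linear f'0)), g' => x; rewrite /= opprB addrC subrK.
Qed.

Fact scaleXn_linear (U : lmodType B) n :
  linear (fun x : res U => 'X^n *: (x : U) : res U).
Proof.
move=> a x y; rewrite !restrict_scaleE scalerDr !scalerA.
by rewrite commr_polyXn.
Qed.
Definition scaleXn n (U : lmodType B) : {linear res U -> res U} :=
  mk_linear (@scaleXn_linear U n).

Lemma cobounds_precompX n i (f : F i -> N) :
  cobounds (P := restrictF) (N := res N) f ->
  cobounds (P := restrictF) (N := res N) (fun x => f ('X^n *: x)).
Proof.
apply: (@cobounds_chain_map _ _ _ restrictF restrictF (fun n' => scaleXn n (F n'))) => j x.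
exact: (linearZZ (pr_d F j)).
Qed.

Section Nilpotent.
Variables (p i : nat).
Hypotheses (M_nil : forall x : M, 'X^p *: x = 0).
Hypotheses (N_nil : forall x : N, 'X^p *: x = 0).
Hypothesis acyclic : forall g : {linear F i -> N}, cocycle g -> cobounds g.
Implicit Type f : {linear res (F i) -> res N}.
Local Notation coboundsR := (cobounds (P := restrictF) (N := res N)).

(** On H^i(Hom_R(F, N)), theta has kernel the image of H^i(Hom_B(F, N)), which
    is zero by hypothesis. *)
Lemma theta_injective f : cocycle (P := restrictF) f -> coboundsR (theta f) -> coboundsR f.
Proof.
move=> fc /theta_cobounds[g fg].
have gc : cocycle g.
  move=> x; have := cobounds_d (P := restrictF) x fg; rewrite (fc x) sub0r => /eqP.
  by rewrite oppr_eq0 => /eqP.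
apply: cobounds_eq (coboundsB fg (coboundsN (cobounds_restrict (acyclic gc)))) => x.
by rewrite opprK subrK.
Qed.

(** Let r be the action of 'X on the cohomology through F.  Modulo coboundaries
    theta (r^n f) = r^n ('X f) - r^(n+1) f = - r^(n+1) f, so that r^(n+1) f = 0
    forces r^n f = 0; and r^p = 0 because 'X^p on F lifts the zero map of M. *)
Lemma precompX_injective f :
  cocycle (P := restrictF) f -> coboundsR (fun x => 'X *: (f x : N)) -> coboundsR f.
Proof.
move=> fc Xf_cob.
have step (n : nat) : coboundsR (fun x => f ('X^(n.+1) *: (x : F i))) ->
              coboundsR (fun x => f ('X^n *: (x : F i))).
  move=> cobS; pose fn := f \o scaleXn n (F i).
  apply: (@theta_injective fn).
    by move=> x; rewrite /= -(linearZZ (pr_d F i)); apply: fc.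
  apply: cobounds_eq (coboundsB (cobounds_precompX n Xf_cob) cobS) => x.
  by rewrite /theta /= scalerA -exprSr.
have all n : coboundsR (fun x => f ('X^n *: (x : F i))) -> coboundsR f.
  elim: n => [|n IH]; last by move/step.
  by apply: cobounds_eq => x; rewrite scale1r.
apply: (all p); apply: (@cobounds_homotopic _ _ _ restrictF restrictF (fun n => scaleXn p (F n))) => //.
  by move=> x; rewrite /= linearZZ M_nil.
by move=> n x; apply: (linearZZ (pr_d F n)).
Qed.

(** The action of 'X on the cohomology through N is injective by the previous
    lemma, and nilpotent because 'X^p kills N. *)
Lemma acyclic_restrict f : cocycle (P := restrictF) f -> coboundsR f.
Proof.
have all (n : nat) (g : {linear res (F i) -> res N}) : cocycle (P := restrictF) g ->
    coboundsR (fun x => 'X^n *: (g x : N)) -> coboundsR g.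
  elim: n g => [|n IH] g gc; first by apply: cobounds_eq => x; rewrite scale1r.
  move=> gcob; apply: (IH) => //.
  apply: (@precompX_injective (scaleXn n N \o g)).
    by move=> x; rewrite /= gc scaler0.
  by apply: cobounds_eq gcob => x; rewrite /= scalerA -exprS.
move=> fc; apply: (all p) => //; apply: cobounds_eq (cobounds0 _ _ i) => x.
by rewrite N_nil.
Qed.

End Nilpotent.

End Transfer.

Variables (M N : lmodType B) (p : nat).
Hypotheses (M_nil : forall x : M, 'X^p *: x = 0).
Hypotheses (N_nil : forall x : N, 'X^p *: x = 0).

Lemma Ext_neq0_poly i :
  Ext_neq0 (res M : lmodType R) (res N) i -> Ext_neq0 M N i.
Proof.
pose F := free_resolution M.
move/(@Ext_neq0_resolution _ _ _ (restrictF F)) => [f [fc fncob]].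
apply: contrapT => noExt; apply/fncob/(acyclic_restrict M_nil N_nil) => //.
move=> g gc; apply: contrapT => gncob; apply: noExt; exists F, g.
by split=> // /coboundaryP.
Qed.

(** Write a cocycle f of degree i.+1 over the polynomial ring as g d with g
    linear over R.  Then theta g is a cocycle of degree i; if it bounds, g can
    be corrected to be linear over the polynomial ring. *)
Lemma Ext_neq0_restrict_poly i : Ext_neq0 M N i.+1 ->
  Ext_neq0 (res M : lmodType R) (res N) i.+1 \/
  Ext_neq0 (res M : lmodType R) (res N) i.
Proof.
move=> [P [f [fc fncob]]]; apply: contrapT => /not_orP[noS no0].
have [g gE] : cobounds (P := restrictF P) (N := res N) f.
  apply: contrapT => fncob'; apply: noS.
  by exists (restrictF P), (restrict_linear _ f); split=> // /coboundaryP.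
pose tg := (scaleX N \o g) \- (g \o scaleX (P i)) : {linear res (P i) -> res N}.
have : cobounds (P := restrictF P) (N := res N) tg.
  apply: contrapT => ncob; apply: no0.
  exists (restrictF P), tg; split=> [x|/coboundaryP //]; rewrite /= -(linearZZ (pr_d P i)).
  have gf (y : P i.+1) : g (pr_d P i y) = f y by rewrite gE.
  by rewrite !gf linearZZ subrr.
move/theta_cobounds=> [g0 gg0]; apply: fncob; exists g0 => x.
by rewrite gE; apply/eqP; rewrite -subr_eq0; apply/eqP/(cobounds_d (P := restrictF P) x gg0).
Qed.

Lemma Ext_infinite_poly :
  Ext_infinite (res M : lmodType R) (res N) <-> Ext_infinite M N.
Proof.
split=> inf n; first by have [i le /Ext_neq0_poly] := inf n; exists i.
have [[//|i] le Ei] := inf n.+1.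
have [Ej|Ej] := Ext_neq0_restrict_poly Ei; last by exists i.
by exists i.+1 => //; apply: leq_trans le.
Qed.


End PolyExt.

(** * Iterated polynomial rings *)

Definition mk_rmorphism (R S : nzRingType) (f : R -> S)
    (f_zmod : zmod_morphism f) (f_monoid : monoid_morphism f) :
    {rmorphism R -> S} :=
  HB.pack f (GRing.isZmodMorphism.Build R S f f_zmod)
    (GRing.isMonoidMorphism.Build R S f f_monoid).

Lemma rmorph_factor (R T S : nzRingType) (pi : {rmorphism R -> T})
    (f : {rmorphism R -> S}) :
    (forall y, exists x, pi x = y) -> (forall x, pi x = 0 -> f x = 0) ->
  exists g : {rmorphism T -> S}, forall x, g (pi x) = f x.
Proof.
move=> surj f0; have [s sK] := choice surj.
have fE x y : pi x = pi y -> f x = f y.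
  move=> xy; apply/eqP; rewrite -subr_eq0 -rmorphB; apply/eqP/f0.
  by rewrite rmorphB xy subrr.
have g_zmod : zmod_morphism (f \o s).
  by move=> x y; rewrite /= -rmorphB; apply: fE; rewrite rmorphB !sK.
have g_monoid : monoid_morphism (f \o s).
  split=> [|x y]; first by rewrite -(rmorph1 f); apply: fE; rewrite sK rmorph1.
  by rewrite /= -rmorphM; apply: fE; rewrite rmorphM !sK.
by exists (mk_rmorphism g_zmod g_monoid) => x; apply: fE; rewrite sK.
Qed.

Lemma rmorph_inverse (R S : nzRingType) (f : {rmorphism R -> S}) (g : S -> R) :
  cancel f g -> cancel g f -> exists h : {rmorphism S -> R}, h =1 g.
Proof.
move=> fK gK.
have g_zmod : zmod_morphism g.
  by move=> x y; apply: (can_inj fK); rewrite rmorphB !gK.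
by exists (mk_rmorphism g_zmod (can2_monoid_morphism fK gK)).
Qed.

Lemma Ext_infinite_iso (R S : nzRingType) (sigma : {rmorphism R -> S})
    (M N : lmodType S) (M' N' : lmodType R)
    (hM : {linear restrict sigma M -> M'}) (hN : {linear restrict sigma N -> N'}) :
    bijective sigma -> bijective hM -> bijective hN ->
  Ext_infinite M N <-> Ext_infinite M' N'.
Proof.
move=> [g sigmaK gK] hM_bij hN_bij.
have [tau tauE] := rmorph_inverse sigmaK gK.
have sigmaK' : cancel sigma tau by move=> x; rewrite tauE sigmaK.
have tauK : cancel tau sigma by move=> x; rewrite tauE gK.
have inv (L : lmodType S) (L' : lmodType R) (h : {linear restrict sigma L -> L'}) :
    bijective h -> exists h' : {linear restrict tau L' -> L}, bijective h'.
  case=> h' hK h'K; have h'_lin : linear (h' : restrict tau L' -> L).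
    move=> a x y; apply: (can_inj hK); rewrite h'K.
    rewrite -[a in RHS]tauK.
    by rewrite [RHS](linearP h (tau a)) !h'K.
  by exists (mk_linear h'_lin), h.
have [[hM' hM'_bij] [hN' hN'_bij]] := (inv _ _ _ hM_bij, inv _ _ _ hN_bij).
split=> inf n; have [i le Ei] := inf n; exists i => //.
  exact: (iso_Ext_neq0 sigmaK' tauK hM_bij hN_bij).
exact: (iso_Ext_neq0 tauK sigmaK' hM'_bij hN'_bij).
Qed.

(** M and N are not changed here, only the ring through which S' acts, so
    the identity maps serve as the semilinear bijections. *)
Lemma Ext_infinite_restrict (R S S' : nzRingType) (sigma : {rmorphism R -> S})
    (rho : {rmorphism S -> S'}) (rho' : {rmorphism R -> S'})
    (M N : lmodType S') :
    bijective sigma -> (forall x, rho (sigma x) = rho' x) ->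
  Ext_infinite (restrict rho M : lmodType S) (restrict rho N) <->
  Ext_infinite (restrict rho' M : lmodType R) (restrict rho' N).
Proof.
move=> sigma_bij rhoE.
have id_lin (L : lmodType S') :
    linear (id : restrict sigma (restrict rho L) -> restrict rho' L).
  by move=> a x y; rewrite !restrict_scaleE rhoE.
by apply: (@Ext_infinite_iso _ _ sigma _ _ _ _ (mk_linear (id_lin M))
  (mk_linear (id_lin N)) sigma_bij); exists id.
Qed.

Section Tower.
Variable A : comNzRingType.

Fixpoint iter_poly (m : nat) : comNzRingType :=
  if m is j.+1 then {poly iter_poly j} else A.

Fixpoint iter_polyC m : {rmorphism A -> iter_poly m} :=
  if m is j.+1 then (@polyC (iter_poly j)) \o iter_polyC j else idfun.

(** The variables of the tower, 'X at level l being number l; the value 0 for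
    larger indices is a default. *)
Fixpoint iter_polyX m : nat -> iter_poly m :=
  if m is j.+1 then fun l => if l == j then 'X else (iter_polyX j l)%:P
  else fun=> 0.

Lemma iter_poly_ext (S : nzRingType) m (f g : {rmorphism iter_poly m -> S}) :
  (forall a, f (iter_polyC m a) = g (iter_polyC m a)) ->
  (forall l, (l < m)%N -> f (iter_polyX m l) = g (iter_polyX m l)) -> f =1 g.
Proof.
elim: m f g => [|m IH] f g fgA fgX x; first exact: fgA.
have fgC a : f a%:P = g a%:P.
  apply: (IH (f \o (@polyC _)) (g \o (@polyC _))) => [a'|l lt]; first exact: fgA.
  have := fgX l (ltnW lt); rewrite /= ifN //; first by apply: contraTneq lt => ->; rewrite ltnn.
have fgX' : f 'X = g 'X by have := fgX m (leqnn _); rewrite /= eqxx.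
elim/poly_ind: x => [|q c IHq]; first by rewrite !rmorph0.
by rewrite !rmorphD !rmorphM IHq fgX' fgC.
Qed.

(** Evaluation takes values in a ring that is only assumed commutative, and not
    in a [comNzRingType]: in this way the module structures obtained by
    restriction along it have the syntactic form under which [kE]-modules are
    restricted elsewhere. *)
Section Eval.
Variables (S : nzRingType) (mulSC : commutative (@GRing.mul S)).
Variables (f0 : {rmorphism A -> S}) (y : nat -> S).

Fixpoint iter_horner m : {rmorphism iter_poly m -> S} :=
  if m is j.+1 then horner_morph (fun x => mulSC (y j) (iter_horner j x)) else f0.

Lemma iter_hornerC m a : iter_horner m (iter_polyC m a) = f0 a.
Proof. by elim: m => //= m IH; rewrite horner_morphC. Qed.

Lemma iter_hornerX m l : (l < m)%N -> iter_horner m (iter_polyX m l) = y l.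
Proof.
elim: m => //= m IH; rewrite ltnS leq_eqVlt => /predU1P[->|lt].
  by rewrite eqxx horner_morphX.
by rewrite ifN ?horner_morphC ?IH // neq_ltn lt.
Qed.

(** The variables are removed one at a time: 'X acts on the restricted modules
    as y_m, and its p-th power as zero. *)
Lemma Ext_infinite_tower (M N : lmodType S) p m :
    (forall l (x : M), (l < m)%N -> y l ^+ p *: x = 0) ->
    (forall l (x : N), (l < m)%N -> y l ^+ p *: x = 0) ->
  Ext_infinite (restrict f0 M : lmodType A) (restrict f0 N) <->
  Ext_infinite (restrict (iter_horner m) M : lmodType (iter_poly m)) (restrict (iter_horner m) N).
Proof.
elim: m => // m IH yM yN.
rewrite IH; [|by move=> l x lt; apply/yM/ltnW|by move=> l x lt; apply/yN/ltnW].
have nil (L : lmodType S) : (forall x : L, y m ^+ p *: x = 0) ->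
    forall x : restrict (iter_horner m.+1) L, ('X^p : iter_poly m.+1) *: x = 0.
  move=> yL x; rewrite restrict_scaleE rmorphXn /= horner_morphX; exact: yL.
have := Ext_infinite_poly (nil _ (fun x => yM m x (leqnn _)))
  (nil _ (fun x => yN m x (leqnn _))) => <-.
have id_lin (L : lmodType S) : linear (id :
    restrict (idfun : {rmorphism iter_poly m -> iter_poly m})
      (restrict (@polyC (iter_poly m)) (restrict (iter_horner m.+1) L)) ->
    restrict (iter_horner m) L).
  by move=> a x y'; rewrite !restrict_scaleE /= horner_morphC.
apply: iff_sym; apply: (@Ext_infinite_iso _ _ idfun _ _ _ _
  (mk_linear (id_lin M)) (mk_linear (id_lin N))); by exists id.
Qed.

End Eval.

End Tower.

(** * The subalgebra k[W] and the quotient Q/J in common coordinates *)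

Lemma rmorph_ideal_of (R S : comNzRingType) (f : {rmorphism R -> S}) (s : seq R) :
  (forall x, x \in s -> f x = 0) -> forall x, x \in ideal_of s -> f x = 0.
Proof.
move=> s0 _ /ideal_ofP[a ->]; rewrite rmorph_sum big1 // => i _.
by rewrite rmorphM [f s`_i]s0 ?mulr0 // mem_nth.
Qed.

Section Substitution.
Variables (k : fieldType) (n : nat).
Local Notation Q := {mpoly k[n]}.

Lemma mpoly_morph_exists (S : comNzRingType) (s : {rmorphism k -> S})
    (h : 'I_n -> S) : exists f : {rmorphism Q -> S},
  (forall a, f a%:MP = s a) /\ (forall i, f 'X_i = h i).
Proof.
exists (mmap s h); split=> [a|i]; first exact: mmapC.
by rewrite /= mmapX mmap1U.
Qed.

Lemma mpoly_morph_ext (S : nzRingType) (f g : {rmorphism Q -> S}) :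
  (forall a, f a%:MP = g a%:MP) -> (forall i, f 'X_i = g 'X_i) -> f =1 g.
Proof.
move=> fgC fgX q; rewrite [q]mpolyE !rmorph_sum; apply: eq_bigr => m _ /=.
rewrite -mul_mpolyC !rmorphM fgC mpolyXE_id !rmorph_prod; congr (_ * _).
by apply: eq_bigr => i _; rewrite !rmorphXn fgX.
Qed.

Lemma frobenius_sum p (S : comNzRingType) (s : {rmorphism k -> S})
    (I : finType) (a : I -> k) (t : I -> S) :
    p \in [pchar k] ->
  (\sum_i s (a i) * t i) ^+ p = \sum_i s (a i) ^+ p * t i ^+ p.
Proof.
move=> char_k; have charS : p \in [pchar S] by apply: rmorph_pchar s _ char_k.
rewrite -(pFrobenius_autE charS) rmorph_sum; apply: eq_bigr => i _.
by rewrite /= pFrobenius_autE exprMn.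
Qed.

Section Truncated.
Variables (p : nat) (char_k : p \in [pchar k]).
Local Notation kE := (@kE k p char_k n).

Definition kE_const : {rmorphism k -> kE} := kE_of char_k \o (@mpolyC n k).
Local Notation x i := (kE_of char_k ('X_i : Q)).

Lemma kE_constE a : kE_const a = a *: 1.
Proof. by rewrite /kE_const /= -[a%:MP]mulr1 mul_mpolyC linearZ rmorph1. Qed.

Lemma kE_expp i : x i ^+ p = 0.
Proof.
rewrite -rmorphXn -(rmorph0 (kE_of char_k)); apply/kE_ofP.
by rewrite subr0; apply/mem_ideal_of/mapP; exists i; rewrite ?mem_enum.
Qed.

Lemma kE_of_surj (y : kE) : exists q, kE_of char_k q = y.
Proof. by exists (repr (y : {ideal_quot (@frobenius_ideal k p n char_k)})); apply: kE_ofK. Qed.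

Lemma kE_of_eq0 (q : Q) : kE_of char_k q = 0 -> q \in @frobenius_ideal k p n char_k.
Proof.
by rewrite -(rmorph0 (kE_of char_k)) => /kE_ofP; rewrite subr0.
Qed.

(** The universal property of the truncated polynomial ring. *)
Lemma kE_morph_exists (S : comNzRingType) (s : {rmorphism k -> S})
    (h : 'I_n -> S) : (forall i, h i ^+ p = 0) ->
  exists f : {rmorphism kE -> S},
    (forall a, f (kE_const a) = s a) /\ (forall i, f (x i) = h i).
Proof.
move=> hp; have [f0 [f0C f0X]] := mpoly_morph_exists s h.
have [f fE] : exists f : {rmorphism kE -> S}, forall q, f (kE_of char_k q) = f0 q.
  apply: rmorph_factor; first exact: kE_of_surj.
  move=> q /kE_of_eq0; apply: rmorph_ideal_of => _ /mapP[i _ ->].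
  by rewrite rmorphXn f0X hp.
by exists f; split=> [a|i]; rewrite /= fE ?f0C ?f0X.
Qed.

Lemma kE_morph_ext (S : nzRingType) (f g : {rmorphism kE -> S}) :
  (forall a, f (kE_const a) = g (kE_const a)) ->
  (forall i, f (x i) = g (x i)) -> f =1 g.
Proof.
move=> fgC fgX y; have [q <-] := kE_of_surj y.
by apply: (mpoly_morph_ext (f := f \o kE_of char_k) (g := g \o kE_of char_k)).
Qed.

End Truncated.
End Substitution.

(** H is the matrix of a change of linear coordinates of Q and G its inverse;
    the first d new coordinates are those that span W. *)
Section Coordinates.
Variables (k : fieldType) (p : nat) (char_k : p \in [pchar k]) (c d : nat).
Variables (le_dc : (d <= c)%N) (H G : 'M[k]_c).
Hypotheses (HG : H *m G = 1%:M) (GH : G *m H = 1%:M).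
Local Notation Q := {mpoly k[c]}.
Local Notation kE := (@kE k p char_k c).
Local Notation kEd := (@Defs.kE k p char_k d).
Local Notation V := (@V k p char_k c).

Definition form (j : 'I_c) : Q := \sum_i H j i *: 'X_i.
Local Notation w := (widen_ord le_dc).
Local Notation ell j := (kE_of char_k (form j)).
Local Notation z j := (kE_of char_k ('X_j : {mpoly k[d]})).

Lemma X_form i : 'X_i = \sum_j G i j *: form j.
Proof.
rewrite /form (eq_bigr _ (fun j _ => scaler_sumr _ _ _ _)) exchange_big /=.
transitivity (\sum_l (G *m H) i l *: 'X_l : Q).
  rewrite GH (bigD1 i) //= mxE eqxx scale1r big1 ?addr0 // => l li.
  by rewrite mxE eq_sym (negPf li) scale0r.
apply: eq_bigr => l _; rewrite mxE scaler_suml; apply: eq_bigr => j _.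
by rewrite scalerA.
Qed.

Lemma rmorph_form (S : nzRingType) (f : {rmorphism Q -> S}) j :
  f (form j) = \sum_i f (H j i)%:MP * f 'X_i.
Proof.
by rewrite rmorph_sum; apply: eq_bigr => i _; rewrite -mul_mpolyC rmorphM.
Qed.

Lemma form_morph_ext (S : nzRingType) (f g : {rmorphism Q -> S}) :
  (forall a, f a%:MP = g a%:MP) -> (forall j, f (form j) = g (form j)) -> f =1 g.
Proof.
move=> fgC fgX; apply: mpoly_morph_ext => // i.
rewrite X_form !rmorph_sum; apply: eq_bigr => j _ /=.
by rewrite -mul_mpolyC !rmorphM fgC fgX.
Qed.

(** Prescribing the values of a ring morphism on the new coordinates: the old
    ones have to be sent to the combinations given by the inverse matrix. *)
Lemma form_subst (S : nzRingType) (f : {rmorphism Q -> S}) (s : {rmorphism k -> S})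
    (t : 'I_c -> S) : (forall a, f a%:MP = s a) ->
    (forall i, f 'X_i = \sum_j s (G i j) * t j) ->
  forall j, f (form j) = t j.
Proof.
move=> fC fX j; rewrite rmorph_form.
transitivity (\sum_l s ((H *m G) j l) * t l); last first.
  rewrite HG (bigD1 j) //= mxE eqxx rmorph1 mul1r big1 ?addr0 // => l lj.
  by rewrite mxE eq_sym (negPf lj) rmorph0 mul0r.
under eq_bigr => i _ do rewrite fC fX mulr_sumr.
rewrite exchange_big; apply: eq_bigr => l _; rewrite mxE rmorph_sum mulr_suml.
by apply: eq_bigr => i _; rewrite rmorphM mulrA.
Qed.

Lemma form_expp j : form j ^+ p \in @frobenius_ideal k p c char_k.
Proof.
rewrite /form; under eq_bigr => i _ do rewrite -mul_mpolyC.
rewrite (frobenius_sum (@mpolyC c k)) //; apply: rpred_sum => i _.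
by apply/ideal_ofMl/mem_ideal_of/mapP; exists i; rewrite ?mem_enum.
Qed.

Lemma ell_expp j : ell j ^+ p = 0.
Proof.
rewrite -rmorphXn -(rmorph0 (kE_of char_k)); apply/kE_ofP.
by rewrite subr0 form_expp.
Qed.

Lemma subst_expp (S : comNzRingType) (s : {rmorphism k -> S}) (t : 'I_c -> S) i :
  (forall j, t j ^+ p = 0) -> (\sum_j s (G i j) * t j) ^+ p = 0.
Proof.
by move=> tp; rewrite frobenius_sum // big1 // => j _; rewrite tp mulr0.
Qed.

(** The embedding of the truncated polynomial ring in d variables into [kE]
    whose image is k[W]. *)
Definition rho_spec (rho : {rmorphism kEd -> kE}) :=
  (forall a, rho (kE_const d char_k a) = kE_const c char_k a) /\
  (forall j, rho (z j) = ell (w j)).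

Lemma rho_exists : exists rho, rho_spec rho.
Proof. by apply: kE_morph_exists => j; apply: ell_expp. Qed.

Section SubalgebraSide.
Variables (W : {vspace kE}) (rho : {rmorphism kEd -> kE}).
Hypothesis rhoP : rho_spec rho.
Hypothesis W_span : W = <<[seq ell (w j) | j <- enum 'I_d]>>%VS.

Lemma rho_in_subalgebra y : rho y \in <<W>>%AS.
Proof.
have one : 1 \in <<W>>%AS by rewrite memvE sub1_agenv.
have [q <-] := kE_of_surj y; rewrite [q]mpolyE !rmorph_sum.
apply: memv_suml => m _ /=; rewrite -mul_mpolyC !rmorphM.
rewrite [rho (kE_of _ _%:MP)]rhoP.1 [kE_const _ _ _]kE_constE -scalerAl mul1r.
apply: memvZ; rewrite mpolyXE_id !rmorph_prod.
apply: (big_ind (fun y => y \in <<W>>%AS)) => // [u v Wu Wv|j _].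
  exact: memvM.
rewrite !rmorphXn rhoP.2; elim: (m j) => [//|e IH]; rewrite exprS.
apply: memvM => //; apply: (subvP (sub_agenv W)); rewrite W_span.
by apply/memv_span/mapP; exists j; rewrite ?mem_enum.
Qed.

(** The induction principle of k[W]. *)
Lemma subalgebra_in (U : {vspace kE}) :
    (forall a b, a \in U -> b \in U -> a * b \in U) -> 1 \in U ->
    (forall j, ell (w j) \in U) -> forall y, y \in <<W>>%AS -> y \in U.
Proof.
move=> UM U1 Uell; apply/subvP/agenv_sub_modl; first by rewrite -memvE.
apply/prodvP => a b Wa Ub; apply: UM => //; move: a Wa; apply/subvP.
by rewrite W_span; apply/span_subvP => _ /mapP[j _ ->].
Qed.

(** Let kappa : kE -> kEd send the first d coordinates to the variables and the
    others to 0.  It is a retraction of rho, and rho kappa is the identity on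
    k[W] because it fixes the generators; so kappa restricts to an isomorphism
    of k[W] with kEd. *)
Lemma Ext_infinite_subalgebra (M N : lmodType kE) :
  Ext_infinite (restrict (subalgebra_val (W := W)) M)
               (restrict (subalgebra_val (W := W)) N) <->
  Ext_infinite (restrict rho M : lmodType kEd) (restrict rho N).
Proof.
pose t (j : 'I_c) : kEd := if insub (j : nat) is Some i then z i else 0.
have tw j : t (w j) = z j by rewrite /t /= valK.
have tp j : t j ^+ p = 0.
  rewrite /t; case: insub => [i|]; first exact: kE_expp.
  have /prime_gt0 := pcharf_prime char_k.
  by rewrite lt0n expr0n => /negPf ->.
have [kappa [kappaC kappaX]] := kE_morph_exists char_k
  (kE_const d char_k) (fun i => subst_expp (kE_const d char_k) i tp).
have kappa_ell j : kappa (ell j) = t j.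
  exact: (form_subst (f := kappa \o kE_of char_k) (s := kE_const d char_k)).
have kappa_rho x : kappa (rho x) = x.
  apply: (kE_morph_ext (f := kappa \o rho) (g := idfun)) => [a|j] /=.
    by rewrite rhoP.1 kappaC.
  by rewrite rhoP.2 kappa_ell tw.
pose f := kappa \o subalgebra_val (W := W).
have rho_kappa_lin : linear (rho \o kappa).
  move=> a x y /=; rewrite !rmorphD -[a *: x]mul1r -scalerAr scalerAl.
  by rewrite -kE_constE !rmorphM kappaC rhoP.1 kE_constE -scalerAl mul1r.
have rho_kappa y : y \in <<W>>%AS -> rho (kappa y) = y.
  pose L := linfun (mk_linear rho_kappa_lin).
  have LE x : (x \in lker (L - \1)%VF) = (rho (kappa x) == x).
    by rewrite memv_ker add_lfunE opp_lfunE id_lfunE lfunE subr_eq0.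
  move=> Wy; apply/eqP; rewrite -LE; apply: subalgebra_in Wy => [a b||j].
  - by rewrite !LE !rmorphM => /eqP -> /eqP ->.
  - by rewrite LE !rmorph1.
  - by rewrite LE kappa_ell tw rhoP.2.
have f_bij : bijective f.
  exists (fun y => vsproj <<W>>%AS (rho y)) => [x|y].
    by apply: val_inj; rewrite /= vsprojK rho_kappa // subvsP.
  by rewrite /f /= /subalgebra_val vsprojK ?kappa_rho ?rho_in_subalgebra.
have fE (x : subalgebra W) : rho (f x) = subalgebra_val x.
  exact/rho_kappa/subvsP.
have EP := @Ext_infinite_restrict (subalgebra W) kEd kE f rho
  (subalgebra_val (W := W)) M N f_bij fE.
exact (iff_sym EP).
Qed.

End SubalgebraSide.

Section QuotientSide.
Variables (W : {vspace V}) (rho : {rmorphism kEd -> kE}).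
Hypothesis rhoP : rho_spec rho.
Hypothesis ell_in : forall j, form (w j) ^+ p \in lift_ideal W.
Hypothesis lift_in : forall v, v \in vbasis W ->
  exists a : 'I_d -> k, V_lift v = \sum_j a j *: form (w j) ^+ p.

Local Notation m := (c - d)%N.
Local Notation Pm := (iter_poly kEd m).

Definition QJ_of : {rmorphism Q -> QJ W} := \pi_{ideal_quot lift_ideal W}.

Lemma QJ_of_surj x : exists q, QJ_of q = x.
Proof. by exists (repr (x : {ideal_quot lift_ideal W})); apply: reprK. Qed.

Lemma QJ_of_eq0 q : (QJ_of q = 0) <-> (q \in lift_ideal W).
Proof.
rewrite -(rmorph0 QJ_of); split=> [/quot_piP|qJ]; first by rewrite subr0.
by apply/quot_piP; rewrite subr0.
Qed.

(** The element of the iterated polynomial ring that corresponds to the j-th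
    coordinate: a generator of [kEd] if j < d, one of the added variables
    otherwise. *)
Definition tower_coord (j : 'I_c) : Pm :=
  if insub (j : nat) is Some i then iter_polyC kEd m (z i) else iter_polyX kEd m (j - d).

(** The values of the added variables under g. *)
Definition extra (S : nzRingType) (g : {rmorphism Q -> S}) (l : nat) : S :=
  if insub (d + l)%N is Some j then g (form j) else 0.

Lemma tower_coord_w j : tower_coord (w j) = iter_polyC kEd m (z j).
Proof. by rewrite /tower_coord /= valK. Qed.

Lemma ltn_extra l : (l < m)%N -> (d + l < c)%N.
Proof. by rewrite ltn_subRL. Qed.

Lemma extraE (S : nzRingType) (g : {rmorphism Q -> S}) l (lt : (d + l < c)%N) :
  extra g l = g (form (Ordinal lt)).
Proof. by rewrite /extra insubT. Qed.

Lemma tower_coord_extra l (lt : (d + l < c)%N) :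
  tower_coord (Ordinal lt) = iter_polyX kEd m l.
Proof. by rewrite /tower_coord insubF /= ?addKn // ltnNge leq_addr. Qed.

Lemma split_coord (P : 'I_c -> Prop) :
  (forall j, P (w j)) -> (forall l (lt : (d + l < c)%N), P (Ordinal lt)) ->
  forall j, P j.
Proof.
move=> Pw Pe j; have [lt|ge] := ltnP j d.
  by have -> : j = w (Ordinal lt) by apply: val_inj.
have lt : (d + (j - d) < c)%N by rewrite subnKC.
by have -> : j = Ordinal lt by apply: val_inj; rewrite /= subnKC.
Qed.

(** A morphism psi that sends the coordinates of Q to their counterparts in the
    iterated polynomial ring is undone by evaluation.  This is used with g the
    projection to Q/J, and with g the projection to [kE]. *)
Lemma tower_eval (S : nzRingType) (mulSC : commutative (@GRing.mul S)) (g : {rmorphism Q -> S})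
    (f0 : {rmorphism kEd -> S}) (psi : {rmorphism Q -> Pm}) :
    (forall a, f0 (kE_const d char_k a) = g a%:MP) ->
    (forall j, f0 (z j) = g (form (w j))) ->
    (forall a, psi a%:MP = iter_polyC kEd m (kE_const d char_k a)) ->
    (forall j, psi (form j) = tower_coord j) ->
  forall q, iter_horner mulSC f0 (extra g) m (psi q) = g q.
Proof.
move=> f0C f0X psiC psiX.
apply: (form_morph_ext (f := iter_horner mulSC f0 (extra g) m \o psi)) => [a|] /=.
  by rewrite psiC iter_hornerC.
apply: split_coord => [j|l lt]; rewrite psiX.
  by rewrite tower_coord_w iter_hornerC.
by rewrite tower_coord_extra iter_hornerX ?extraE // ltn_subRL.
Qed.

Lemma tower_morph_exists : exists psi : {rmorphism QJ W -> Pm},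
  (forall a, psi (QJ_of a%:MP) = iter_polyC kEd m (kE_const d char_k a)) /\
  (forall j, psi (QJ_of (form j)) = tower_coord j).
Proof.
pose s : {rmorphism k -> Pm} := iter_polyC kEd m \o kE_const d char_k.
have [psi0 [psi0C psi0X]] := mpoly_morph_exists s
  (fun i => \sum_j s (G i j) * tower_coord j).
have psi0F := form_subst psi0C psi0X.
have [psi psiE] : exists psi : {rmorphism QJ W -> Pm},
    forall q, psi (QJ_of q) = psi0 q.
  apply: rmorph_factor; first exact: QJ_of_surj.
  move=> q /QJ_of_eq0; apply: rmorph_ideal_of => _ /mapP[v /lift_in[a ->] ->].
  rewrite rmorph_sum big1 // => j _ /=; rewrite -mul_mpolyC rmorphM rmorphXn.
  by rewrite psi0F tower_coord_w -rmorphXn kE_expp rmorph0 mulr0.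
by exists psi; split=> [a|j]; rewrite psiE ?psi0C ?psi0F.
Qed.

(** psi : Q/J -> kEd[y_1, ..., y_m] and evaluation ev are inverse to each other,
    since both composites fix the generators, and psi is compatible with the
    two maps to [kE]. *)
Lemma Ext_infinite_quotient (M N : lmodType kE) :
  Ext_infinite (restrict rho M : lmodType kEd) (restrict rho N) <->
  Ext_infinite (restrict (@QJ_to_kE k p char_k c W) M)
               (restrict (@QJ_to_kE k p char_k c W) N).
Proof.
have [psi [psiC psiX]] := tower_morph_exists.
have ell_exp j : QJ_of (form (w j)) ^+ p = 0.
  by rewrite -rmorphXn; apply/QJ_of_eq0.
have [phi0 [phi0C phi0X]] := kE_morph_exists char_k
  (QJ_of \o @mpolyC c k : {rmorphism k -> QJ W}) ell_exp.
pose ev := iter_horner (@mulrC (QJ W)) phi0 (extra QJ_of) m.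
pose evk := @iter_horner kEd kE (@mulrC kE) rho (extra (kE_of char_k)) m.
have ev_psi x : ev (psi x) = x.
  have [q <-] := QJ_of_surj x.
  exact: (@tower_eval _ (@mulrC (QJ W)) _ _ (psi \o QJ_of)).
have evk_psi x : evk (psi x) = QJ_to_kE x.
  have [q <-] := QJ_of_surj x; rewrite [RHS]QJ_to_kE_pi.
  by apply: (@tower_eval kE (@mulrC kE) _ _ (psi \o QJ_of));
    [apply: rhoP.1 | apply: rhoP.2 | |].
have psi_ev x : psi (ev x) = x.
  apply: (iter_poly_ext (f := psi \o ev) (g := idfun)) => [a|l lt] /=.
    rewrite /ev iter_hornerC.
    apply: (kE_morph_ext (f := psi \o phi0) (g := iter_polyC kEd m)) => [b|j] /=.
      by rewrite phi0C psiC.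
    by rewrite phi0X psiX tower_coord_w.
  by rewrite /ev iter_hornerX // (extraE _ (ltn_extra lt)) psiX tower_coord_extra.
have nil (L : lmodType kE) l (x : L) : (l < m)%N ->
    extra (kE_of char_k) l ^+ p *: x = 0.
  by move=> lt; rewrite (extraE _ (ltn_extra lt)) ell_expp scale0r.
have towerP : Ext_infinite (restrict rho M : lmodType kEd) (restrict rho N) <->
    Ext_infinite (restrict evk M : lmodType Pm) (restrict evk N).
  exact: (@Ext_infinite_tower kEd kE (@mulrC kE) rho (extra (kE_of char_k)) M N
    p m (nil M) (nil N)).
have isoP : Ext_infinite (restrict evk M : lmodType Pm) (restrict evk N) <->
    Ext_infinite (restrict (@QJ_to_kE k p char_k c W) M)
                 (restrict (@QJ_to_kE k p char_k c W) N).
  exact: (@Ext_infinite_restrict (QJ W) Pm kE psi evk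
    (@QJ_to_kE k p char_k c W) M N (Bijective ev_psi psi_ev) evk_psi).
by split=> [/towerP/isoP|/isoP/towerP].
Qed.

End QuotientSide.

Lemma Ext_infinite_subalgebra_quotient (W : {vspace kE}) (W' : {vspace V}) :
    W = <<[seq ell (w j) | j <- enum 'I_d]>>%VS ->
    (forall j, form (w j) ^+ p \in lift_ideal W') ->
    (forall v, v \in vbasis W' ->
      exists a : 'I_d -> k, V_lift v = \sum_j a j *: form (w j) ^+ p) ->
  forall M N : lmodType kE,
  Ext_infinite (restrict (subalgebra_val (W := W)) M)
               (restrict (subalgebra_val (W := W)) N) <->
  Ext_infinite (restrict (@QJ_to_kE k p char_k c W') M)
               (restrict (@QJ_to_kE k p char_k c W') N).
Proof.
move=> W_span ell_in lift_in M N; have [rho rhoP] := rho_exists.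
have subP := Ext_infinite_subalgebra rhoP W_span M N.
have quoP := Ext_infinite_quotient rhoP ell_in lift_in M N.
exact (iff_trans subP quoP).
Qed.

End Coordinates.

(** * Injectivity of the Pluecker coordinates *)

Section Plucker.
Variables (k : fieldType) (vT : vectType k) (c : nat) (e : c.-tuple vT).

(** Unlike in [plucker], the columns may be repeated or in any order: expanding
    a larger minor along a row does not keep them sorted. *)
Definition coord_minor n (X : seq vT) (f : 'I_n -> 'I_c) : k :=
  \det (\matrix_(i < n, j < n) coord e (f j) X`_i).

Lemma coord_minor_eq n X (f g : 'I_n -> 'I_c) :
  f =1 g -> coord_minor X f = coord_minor X g.
Proof.
by move=> fg; congr (\det _); apply/matrixP => i j; rewrite !mxE fg.
Qed.

Lemma coord_minor_perm n X (f : 'I_n -> 'I_c) (s : 'S_n) :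
  coord_minor X (f \o s) = (-1) ^+ s * coord_minor X f.
Proof.
rewrite /coord_minor mulrC -odd_permV -det_perm -det_mulmx -col_permE.
by congr (\det _); apply/matrixP => i j; rewrite !mxE.
Qed.

Lemma coord_minor_noninj n X (f : 'I_n -> 'I_c) :
  ~ injective f -> coord_minor X f = 0.
Proof.
move=> /injectiveP/injectivePn[i [j ij fij]].
rewrite /coord_minor -det_tr; apply: (determinant_alternate ij) => l.
by rewrite !mxE fij.
Qed.

Lemma coord_minor_cons n v X (f : 'I_n.+1 -> 'I_c) :
  coord_minor (v :: X) f =
  \sum_j coord e (f j) v * ((-1) ^+ j * coord_minor X (f \o lift j)).
Proof.
rewrite /coord_minor (expand_det_row _ ord0); apply: eq_bigr => j _.
rewrite mxE /cofactor add0n; congr (_ * (_ * \det _)).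
by apply/matrixP => i l; rewrite !mxE.
Qed.

Lemma coord_minor_dependent n (X : n.-tuple vT) (f : 'I_n -> 'I_c) :
  ~~ free X -> coord_minor X f = 0.
Proof.
move=> nfree; apply/eqP/det0P.
have [a /existsP[i ai] aX] :
    exists2 a : 'I_n -> k, [exists i, a i != 0] & \sum_i a i *: X`_i = 0.
  apply: contrapT => H; case/negP: nfree; apply/freeP => a aX i.
  apply: contrapT => /eqP ai; apply: H; exists a => //; apply/existsP.
  by exists i.
exists (\row_j a j); first by apply: contraNneq ai => /rowP/(_ i); rewrite !mxE => ->.
apply/rowP => j; rewrite !mxE; under eq_bigr => l _ do rewrite !mxE.
have := congr1 (coord e (f j)) aX; rewrite linear_sum linear0 /= => eX.
by rewrite -[RHS]eX; apply: eq_bigr => l _; rewrite linearZ.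
Qed.

(** The coordinate matrix has full rank, so some square submatrix is
    invertible. *)
Lemma coord_minor_free n (X : n.-tuple vT) :
    free X -> (forall i : 'I_n, X`_i \in <<e>>%VS) ->
  exists f : 'I_n -> 'I_c, coord_minor X f != 0.
Proof.
move=> /freeP Xfree Xe; pose D : 'M_(n, c) := \matrix_(i, j) coord e j X`_i.
have Dfree : row_free D.
  apply: inj_row_free => u uD; apply/rowP => i; rewrite mxE.
  apply: (Xfree (fun i => u 0 i)); under eq_bigr => l _ do rewrite (coord_span (Xe l)).
  under eq_bigr => l _ do rewrite scaler_sumr.
  rewrite exchange_big big1 // => j _ /=.
  have := congr1 (fun A : 'rV_c => A 0 j) uD; rewrite !mxE => uDj.
  rewrite -[RHS](scale0r e`_j) -uDj scaler_suml; apply: eq_bigr => l _.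
  by rewrite mxE scalerA.
have Tfull : row_full D^T by rewrite /row_full mxrank_tr.
exists (fullrankfun Tfull); rewrite -unitfE -[coord_minor _ _]det_tr.
have := fullrowsub_unit Tfull; rewrite unitmxE; congr (\det _ \is a GRing.unit).
by apply/matrixP => i j; rewrite !mxE.
Qed.

Section SubspaceFromMinors.
Variables (d : nat) (W W' : {vspace vT}).

(** Minors on repeated columns vanish, and sorting distinct columns changes a
    minor by a sign that is the same for W and W'. *)
Lemma coord_minor_plucker b :
    plucker d e W' = b *: plucker d e W ->
  forall f : 'I_d -> 'I_c,
    coord_minor (vbasis W') f = b * coord_minor (vbasis W) f.
Proof.
move=> plE f; have [f_inj|] := pselect (injective f); last first.
  by move=> ninj; rewrite !coord_minor_noninj // mulr0.
have cardS : #|[set f j | j : 'I_d]| == d by rewrite card_imset // card_ord.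
pose S : minor_index c d := exist _ [set f j | j : 'I_d] cardS.
have surj j : exists i, minor_column S i = f j.
  have fjS : f j \in val S by apply: imset_f.
  exists (cast_ord (eqP (valP S)) (enum_rank_in fjS (f j))).
  by rewrite /minor_column cast_ordK enum_rankK_in.
have [g gE] := choice surj.
have g_inj : injective g by move=> i j gij; apply: f_inj; rewrite -!gE gij.
have fE : f =1 minor_column S \o perm g_inj by move=> j; rewrite /= permE gE.
rewrite !(coord_minor_eq _ fE) !coord_minor_perm mulrCA; congr (_ * _).
by have := congr1 (fun u : plucker_space k c d => u S) plE; rewrite !ffunE.
Qed.

(** A vector v lies in W exactly when all maximal minors of v together with a
    basis of W vanish.  By expansion along v, these minors depend only on the
    minors of W, so they vanish for W' if they do for W. *)
Lemma plucker_subv :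
    \dim W = d -> \dim W' = d -> (W' <= <<e>>)%VS -> (W <= <<e>>)%VS ->
    plucker_point d e W = plucker_point d e W' -> (W <= W')%VS.
Proof.
move=> dW dW' W'e We ptE.
have /vlineP[b plE] : plucker d e W' \in plucker_point d e W.
  by rewrite ptE memv_line.
apply/subvP => v Wv; apply: contrapT => /negP W'v.
have sz U : \dim U = d -> size (v :: vbasis U) == d.+1.
  by move=> <-; rewrite /= size_tuple.
have [] := @coord_minor_free _ (Tuple (sz _ dW')).
- by rewrite /= free_cons (span_basis (vbasisP W')) W'v (basis_free (vbasisP W')).
- move=> [[|i] lt]; first exact: (subvP We _ Wv).
  by apply: (subvP W'e (vbasis W')`_i); apply/vbasis_mem/mem_nth; rewrite size_tuple dW'.
move=> f /eqP[] /=; rewrite coord_minor_cons.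
have := @coord_minor_dependent _ (Tuple (sz _ dW)) f.
rewrite /= free_cons (span_basis (vbasisP W)) Wv => /(_ isT).
rewrite coord_minor_cons => /(congr1 ( *%R b)); rewrite mulr0 mulr_sumr => bX.
rewrite -[RHS]bX; apply: eq_bigr => j _; rewrite (coord_minor_plucker plE).
by rewrite 2!(mulrCA _ b).
Qed.

End SubspaceFromMinors.

Lemma plucker_point_inj d (W W' : {vspace vT}) :
    \dim W = d -> \dim W' = d -> (W <= <<e>>)%VS -> (W' <= <<e>>)%VS ->
    plucker_point d e W = plucker_point d e W' -> W = W'.
Proof.
move=> dW dW' We W'e ptE; apply/eqP; rewrite eqEsubv.
by rewrite (plucker_subv dW dW') ?(plucker_subv dW' dW).
Qed.

End Plucker.

(** * The p-th power map on linear forms *)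

Section Alpha.
Variables (k : closedFieldType) (p : nat) (char_k : p \in [pchar k]) (c : nat).
Local Notation Q := {mpoly k[c]}.
Local Notation kE := (@kE k p char_k c).
Local Notation V := (@V k p char_k c).
Local Notation kE1 := (kE1 char_k c).
Local Notation alpha := (@alpha k p char_k c).
Local Notation x i := (kE_of char_k ('X_i : Q)).

Lemma p_root (a : k) : exists r, r ^+ p = a.
Proof.
have p_gt0 : (0 < p)%N := prime_gt0 (pcharf_prime char_k).
have /closed_rootP[r /rootP] : size ('X^p - a%:P) != 1%N.
  by rewrite size_XnsubC // eqSS -lt0n.
by rewrite !hornerE => /eqP; rewrite subr_eq0 => /eqP; exists r.
Qed.

Lemma frobenius_sum_k (I : finType) (a b : I -> k) :
  (\sum_i a i * b i) ^+ p = \sum_i a i ^+ p * b i ^+ p.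
Proof. exact: (frobenius_sum idfun). Qed.

Lemma expp_eq0 (a : k) : a ^+ p = 0 -> a = 0.
Proof. by move/eqP; rewrite expf_eq0 => /andP[_ /eqP]. Qed.

Lemma V_coef_linear : linear (@V_coef k p char_k c).
Proof.
move=> a u v; rewrite -{1}[u]V_reprK -{1}[v]V_reprK -linearP.
apply/rowP => i; rewrite V_coef_class.
have -> : val (a *: V_repr u + V_repr v) =
    a *: val (V_repr u) + val (V_repr v) :> Q by [].
by rewrite mcoeffD mcoeffZ !mxE.
Qed.

Definition V_coefL : {linear V -> 'rV[k]_c} := mk_linear V_coef_linear.

Lemma V_coef_inj : injective (@V_coef k p char_k c).
Proof.
by move=> u v uv; rewrite -[u]V_liftK -[v]V_liftK; congr (V_class _); apply: val_inj; rewrite /= uv.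
Qed.

Lemma V_coef_sum (I : finType) (a : I -> k) (v : I -> V) i :
  V_coef (\sum_j a j *: v j) 0 i = \sum_j a j * V_coef (v j) 0 i.
Proof.
have -> : V_coef (\sum_j a j *: v j) = \sum_j a j *: V_coef (v j).
  rewrite -[LHS]/(V_coefL _) linear_sum; apply: eq_bigr => j _.
  exact: (linearZZ V_coefL).
by rewrite summxE; apply: eq_bigr => j _; rewrite [LHS]mxE.
Qed.

Lemma V_lift_sum (I : finType) (a : I -> k) (v : I -> V) :
  V_lift (\sum_j a j *: v j) = \sum_j a j *: V_lift (v j).
Proof.
rewrite /V_lift; under [RHS]eq_bigr => j _ do rewrite scaler_sumr.
rewrite exchange_big; apply: eq_bigr => i _ /=.
rewrite V_coef_sum scaler_suml; apply: eq_bigr => j _.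
by rewrite scalerA.
Qed.

Lemma kE1_lin u : u \in kE1 -> exists a : 'I_c -> k,
  u = kE_of char_k (\sum_j a j *: 'X_j).
Proof.
rewrite /Defs.kE1 -[[seq _ | _ <- _]]/(val [tuple of [seq x i | i <- ord_tuple c]]).
move=> /coord_span ->; set X := [tuple of _].
exists (fun j => coord X j u); rewrite linear_sum; apply: eq_bigr => j _.
by rewrite linearZ /= (nth_map j) ?size_enum_ord // nth_ord_enum.
Qed.

Lemma lin_kE1 (a : 'I_c -> k) : kE_of char_k (\sum_j a j *: 'X_j) \in kE1.
Proof.
rewrite linear_sum; apply: memv_suml => j _; rewrite linearZ; apply: memvZ.
by apply/memv_span/mapP; exists j; rewrite ?mem_enum.
Qed.

Lemma alpha_semilinear (I : finType) (r : I -> k) (u : I -> kE) :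
  (forall j, u j \in kE1) ->
  alpha (\sum_j r j *: u j) = \sum_j r j ^+ p *: alpha (u j).
Proof.
move=> uE; have [a aE] := choice (fun j => kE1_lin (uE j)).
have -> : \sum_j r j *: u j =
    kE_of char_k (\sum_i (\sum_j r j * a j i) *: 'X_i).
  transitivity (\sum_j kE_of char_k (r j *: \sum_i a j i *: 'X_i)).
    by apply: eq_bigr => j _; rewrite aE linearZ.
  rewrite -linear_sum.
  congr (kE_of _ _); under eq_bigr => j _ do rewrite scaler_sumr.
  rewrite exchange_big; apply: eq_bigr => i _; rewrite scaler_suml.
  by apply: eq_bigr => j _; rewrite scalerA.
apply/V_coef_inj/rowP => i; rewrite alpha_linear_form frobenius_sum_k.
rewrite V_coef_sum; apply: eq_bigr => j _.
by rewrite [in RHS]aE alpha_linear_form.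
Qed.

Lemma alpha0 : alpha 0 = 0.
Proof.
have := alpha_semilinear (fun _ : 'I_0 => 0 : k) (fun=> mem0v kE1).
by rewrite !big_ord0.
Qed.

Lemma alpha_eq0 u : u \in kE1 -> alpha u = 0 -> u = 0.
Proof.
move=> /kE1_lin[a ->] /(congr1 V_coefL); rewrite linear0 => /rowP a0.
rewrite big1 ?rmorph0 // => j _.
have := a0 j; rewrite /= alpha_linear_form mxE => /expp_eq0 ->.
by rewrite scale0r.
Qed.

Lemma alpha_surj v : exists2 u, u \in kE1 & alpha u = v.
Proof.
have [a aE] := choice (fun i => p_root (V_coef v 0 i)).
exists (kE_of char_k (\sum_j a j *: 'X_j)); first exact: lin_kE1.
by apply/V_coef_inj/rowP => i; rewrite alpha_linear_form aE.
Qed.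

(** A linear relation between the images has coefficients r_i^p, and is then the
    image of a relation with coefficients r_i, because alpha is p-semilinear and
    has zero kernel. *)
Lemma alpha_free n (X : n.-tuple kE) : (forall i : 'I_n, X`_i \in kE1) ->
  free (map_tuple alpha X) = free X.
Proof.
move=> XE; have mapE (i : 'I_n) : (map_tuple alpha X)`_i = alpha X`_i.
  by rewrite (nth_map 0) ?size_tuple.
apply/freeP/freeP => freeX a aX i.
  apply: expp_eq0; apply: (freeX (fun i => a i ^+ p)).
  under eq_bigr => j _ do rewrite mapE.
  by rewrite -(alpha_semilinear a XE) aX alpha0.
have [r rE] := choice (fun i => p_root (a i)).
suff -> : a i = r i ^+ p.
  rewrite (freeX r) ?expr0n ?gtn_eqF ?(prime_gt0 (pcharf_prime char_k)) //.
  apply: alpha_eq0; first by apply: memv_suml => j _; apply/memvZ/XE.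
  rewrite alpha_semilinear // -[RHS]aX; apply: eq_bigr => j _.
  by rewrite rE mapE.
by rewrite rE.
Qed.

Section Subspace.
Variable W : {vspace kE}.
Hypothesis W_sub : (W <= kE1)%VS.

Lemma vbasis_kE1 (i : 'I_(\dim W)) : (vbasis W)`_i \in kE1.
Proof.
by apply/(subvP W_sub)/vbasis_mem/mem_nth; rewrite size_tuple.
Qed.

Lemma dim_alpha_space : \dim (alpha_space W) = \dim W.
Proof.
have := alpha_free vbasis_kE1; rewrite (basis_free (vbasisP W)).
by move/eqnP; rewrite size_tuple.
Qed.

Lemma alpha_in_space u : u \in W -> alpha u \in alpha_space W.
Proof.
move/coord_vbasis => ->; rewrite (alpha_semilinear _ vbasis_kE1).
apply: memv_suml => j _; apply/memvZ/memv_span/map_f/mem_nth.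
by rewrite size_tuple.
Qed.

(** The lift of alpha(u) chosen in the definition of [lift_ideal] is the p-th
    power of the linear form that lifts u. *)
Lemma V_lift_form (a : 'I_c -> k) :
  V_lift (alpha (kE_of char_k (\sum_j a j *: 'X_j))) =
  (\sum_j a j *: 'X_j) ^+ p.
Proof.
under [in RHS]eq_bigr => i _ do rewrite -mul_mpolyC.
rewrite (frobenius_sum (@mpolyC c k)) //; apply: eq_bigr => i _.
by rewrite alpha_linear_form -mul_mpolyC rmorphXn.
Qed.

Lemma V_lift_in (W' : {vspace V}) v : v \in W' -> V_lift v \in lift_ideal W'.
Proof.
move/coord_vbasis => ->; rewrite V_lift_sum; apply: rpred_sum => j _.
rewrite -mul_mpolyC; apply/ideal_ofMl/mem_ideal_of/map_f/mem_nth.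
by rewrite size_tuple.
Qed.

(** Complete a basis of W to one of kE_1; H and G are the transition matrices
    between that basis and the x_i. *)
Lemma Ext_infinite_alpha_space (M N : lmodType kE) : \dim kE1 = c ->
  Ext_infinite (restrict (subalgebra_val (W := W)) M)
               (restrict (subalgebra_val (W := W)) N) <->
  Ext_infinite (restrict (@QJ_to_kE k p char_k c (alpha_space W)) M)
               (restrict (@QJ_to_kE k p char_k c (alpha_space W)) N).
Proof.
move=> dim_kE1; pose d := \dim W.
have le_dc : (d <= c)%N by rewrite -dim_kE1; apply: dimvS.
pose b : seq kE := vbasis W ++ vbasis (kE1 :\: W)%VS.
have b_basis : basis_of kE1 b.
  have -> : kE1 = (W + (kE1 :\: W))%VS.
    by rewrite addvC addv_diff; apply/esym/addv_idPl.
  apply: cat_basis; try exact: vbasisP.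
  by apply/directv_addP; rewrite capvC capv_diff.
have b_size : size b == c.
  have /eqnP <- := basis_free b_basis.
  by rewrite (span_basis b_basis) dim_kE1.
pose bt : c.-tuple kE := Tuple b_size.
have bt_in (j : 'I_c) : bt`_j \in kE1.
  by apply: (basis_mem b_basis); rewrite mem_nth ?(eqP b_size).
have [h hE] := choice (fun j => kE1_lin (bt_in j)).
pose H := \matrix_(j, i) h j i : 'M[k]_c.
have x_in i : x i \in kE1 by apply/memv_span/map_f; rewrite mem_enum.
pose G := \matrix_(i, l) coord bt l (x i) : 'M[k]_c.
have ellE j : kE_of char_k (form H j) = bt`_j.
  by rewrite hE /form; congr (kE_of _ _); apply: eq_bigr => i _; rewrite mxE.
have HG : H *m G = 1%:M.
  apply/matrixP => j l; rewrite !mxE.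
  have <- := @coord_free _ _ _ bt j l (basis_free b_basis).
  rewrite -ellE /form linear_sum linear_sum; apply: eq_bigr => i _.
  by rewrite !linearZ /= !mxE.
have GH : G *m H = 1%:M by apply: mulmx1C.
have btw (j : 'I_d) : bt`_(widen_ord le_dc j) = (vbasis W)`_j.
  by rewrite /= nth_cat size_tuple ltn_ord.
have formw j : form H (widen_ord le_dc j) ^+ p = V_lift (alpha (vbasis W)`_j).
  rewrite -btw -ellE /form; under eq_bigr => i _ do rewrite mxE.
  by rewrite V_lift_form.
apply: (Ext_infinite_subalgebra_quotient (le_dc := le_dc) HG GH) => [|j|v].
- rewrite -[LHS](span_basis (vbasisP W)); congr (<<_>>%VS).
  apply: (@eq_from_nth _ 0) => [|i]; first by rewrite size_map size_enum_ord size_tuple.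
  rewrite size_tuple => lt; rewrite (nth_map (Ordinal lt)) ?size_enum_ord //.
  rewrite ellE btw; congr (_`_ _).
  by rewrite -[i in RHS]/(val (Ordinal lt)) nth_ord_enum.
- rewrite formw; apply/V_lift_in/alpha_in_space/vbasis_mem/mem_nth.
  by rewrite size_tuple.
- move=> /vbasis_mem.
  rewrite /alpha_space -[[seq _ | _ <- _]]/(val (map_tuple alpha (vbasis W))).
  move=> /coord_span ->; rewrite V_lift_sum.
  exists (fun j => coord (map_tuple alpha (vbasis W)) j v).
  apply: eq_bigr => j _; rewrite formw.
  by congr (_ *: V_lift _); rewrite (nth_map 0) ?size_tuple.
Qed.

End Subspace.

Lemma alpha_space_surj (W' : {vspace V}) : exists W : {vspace kE},
  [/\ (W <= kE1)%VS, \dim W = \dim W' & alpha_space W = W'].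
Proof.
pose n := \dim W'; pose v : n.-tuple V := vbasis W'.
have preim (j : 'I_n) : exists y, y \in kE1 /\ alpha y = v`_j.
  by have [y yE yv] := alpha_surj v`_j; exists y.
have [u uE] := choice preim.
pose X : n.-tuple kE := [tuple u j | j < n].
have XE (j : 'I_n) : X`_j = u j by rewrite -tnth_nth tnth_mktuple.
have X_in (j : 'I_n) : X`_j \in kE1 by rewrite XE; case: (uE j).
have mapX : map_tuple alpha X = v.
  apply/eq_from_tnth => j; rewrite tnth_map tnth_mktuple.
  by case: (uE j) => _ ->; rewrite (tnth_nth 0).
have X_free : free X by rewrite -(alpha_free X_in) mapX (basis_free (vbasisP W')).
have W_sub : (<<X>> <= kE1)%VS.
  by apply/span_subvP => _ /tnthP[j ->]; rewrite (tnth_nth 0).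
have dimX : \dim <<X>> = n by rewrite (eqnP X_free) size_tuple.
exists <<X>>%VS; split=> //; apply/esym/eqP.
rewrite eqEdim dim_alpha_space // dimX leqnn andbT.
rewrite -{1}(span_basis (vbasisP W')) -[vbasis W']/v -mapX.
by apply/span_subvP => _ /mapP[y Xy ->]; apply/alpha_in_space/memv_span.
Qed.

End Alpha.

Theorem theorem4p2 (k : closedFieldType) (p : nat) (char_k : p \in [pchar k])
    (c d : nat) (d_bounds : (1 <= d <= c)%N)
    (e : c.-tuple (kE char_k c)) (e_basis : basis_of (kE1 char_k c) e)
    (M N : lmodType (kE char_k c))
    (M_fg : finitely_generated M) (N_fg : finitely_generated N) :
  (beta d e @` rank_variety d e M N)%classic =
    support_variety d (map_tuple alpha e) M N.
Proof.
have dim_kE1 : \dim (kE1 char_k c) = c  :=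
  vector.size_basis e_basis.
have pointK (W : {vspace kE char_k c}) : (W <= kE1 char_k c)%VS -> \dim W = d ->
    subspace_of_point e (plucker_point d e W) = W.
  move=> W_sub dimW; apply: xget_unique => [//|W' [W'_sub dimW' pt]].
  apply: (plucker_point_inj (e := e) dimW' dimW) => //.
  - by rewrite (span_basis e_basis).
  - by rewrite (span_basis e_basis).
apply/seteqP; split=> [_ [_ [W [W_sub dimW -> inf]] <-]|_ [W' [dimW' -> inf]]].
  exists (alpha_space W); split; first by rewrite dim_alpha_space.
    by rewrite /beta pointK.
  exact/(Ext_infinite_alpha_space W_sub).
have [W [W_sub dimW aW]] := alpha_space_surj W'.
exists (plucker_point d e W); last by rewrite /beta pointK // ?aW // dimW.
exists W; split=> //; first by rewrite dimW.
by apply/(Ext_infinite_alpha_space W_sub); rewrite // aW.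
Qed.
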